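(* Let $E/\mathbb{Q}$ be an elliptic curve given by $y^2=x^3+a_4x+a_6$ with $a_4,a_6\in\mathbb{Z}$, such that $E(\mathbb{Q})$ has positive rank. Suppose that $E/\mathbb{Q}$ has the property that $c_v=1$ for every finite place $v$ of bad reduction. Then the following are true. (1) Suppose that $E(\mathbb{R})$ has one connected component and that $$a_4\leq 0,\qquad (\alpha,\infty)\subset\left\{x\in\mathbb{R}: 2a_4x^2+8a_6x-a_4^2<0\right\},$$ where $\alpha$ is the real root of $x^3+a_4x+a_6$. Then for every $P\in E(\mathbb{Q})$ we have $\widehat{h}(P)\geq\tfrac12 h_W(P)$. (2) Suppose that $E(\mathbb{R})$ has two connected components and that $$a_4\leq 0,\qquad (\gamma,\beta)\cup(\alpha,\infty)\subset\left\{x\in\mathbb{R}: 2a_4x^2+8a_6x-a_4^2<0\right\},$$ where $\gamma<\beta<\alpha$ are the real roots of $x^3+a_4x+a_6$. Then for every $P\in E(\mathbb{Q})$ we have $\widehat{h}(P)\geq\tfrac12 h_W(P)$.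
   Context: Tamagawa numbers: for a finite place $v$ of $\mathbb{Q}$, $E_0(\mathbb{Q}_v)$ is the open subgroup of $E(\mathbb{Q}_v)$ consisting of points whose reduction is non-singular; the quotient $E(\mathbb{Q}_v)/E_0(\mathbb{Q}_v)$ is finite, and the Tamagawa number is $c_v:=|E(\mathbb{Q}_v)/E_0(\mathbb{Q}_v)|$. Heights: each affine point $P\in E(\mathbb{Q})$ is written $P=\left(\frac{A}{C^2},\frac{B}{C^3}\right)$ with $A,B,C\in\mathbb{Z}$ and $\gcd(A,C)=\gcd(B,C)=1$. The naive height is $H(P):=\max(|A|,|C^2|)$, the logarithmic (Weil) height is $h_W(P):=\log H(P)$ (with $h_W=0$ at the identity), and the canonical height is $\widehat{h}(P):=\tfrac12\lim_{n\to\infty}\frac{h_W(nP)}{n^2}$.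
   Formalization: Bad reduction, E_0(Q_v) and c_v are taken for the given equation y^2=x^3+a_4x+a_6 (v is bad if it divides -16(4a_4^3+27a_6^2), so 2 always is), not a minimal model; with minimal models y^2=x^3-16x+16, P=(4,4) is a counterexample. *)

(* Defs.v *)
From HB Require Import structures.
From mathcomp Require Import all_boot all_order all_algebra.
From mathcomp Require Import ring zify.
From mathcomp Require Import finmap.
From mathcomp Require Import all_classical all_reals all_analysis.

Set Implicit Arguments.
Unset Strict Implicit.
Unset Printing Implicit Defensive.

Import Order.TTheory GRing.Theory Num.Theory.
Import numFieldNormedType.Exports.

Local Open Scope classical_set_scope.
Local Open Scope ring_scope.

(* A finite place of Q is a prime number. *)
Definition finite_place := {p : nat | prime p}.

(* [padic_int v] is the inverse limit of the rings Z/p^n, the n-th component   *)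
(* being represented by its residue in [0, p^n), so that Leibniz equality is   *)
(* the intended one.  [padic v] is its field of fractions.                     *)
Section PadicIntegers.
Variable v : finite_place.
Let p : nat := val v.
Let q (n : nat) : int := (p ^ n)%N%:Z.

Record padic_int := PadicInt {
  approx :> nat -> int;
  approxP : forall n, approx n = (approx n.+1 %% (val v ^ n)%N%:Z)%Z }.

HB.instance Definition _ := gen_eqMixin padic_int.
HB.instance Definition _ := gen_choiceMixin padic_int.

Lemma padic_intP (x y : padic_int) : (forall n, x n = y n) -> x = y.
Proof.
case: x y => [x hx] [y hy] /= /funext exy; rewrite exy in hx *.
by congr PadicInt; exact: Prop_irrelevance.
Qed.

Lemma place_gt1 : (1 < p)%N. Proof. exact/prime_gt1/(valP v). Qed.

Lemma modz_qS (m : int) n : ((m %% q n.+1)%Z %% q n)%Z = (m %% q n)%Z.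
Proof.
rewrite [in RHS](divz_eq m (q n.+1)).
have -> : q n.+1 = p%:Z * q n by rewrite /q expnS PoszM.
by rewrite mulrA modzMDl.
Qed.

Lemma approx_mod (x : padic_int) n : (x n %% q n)%Z = x n.
Proof. by rewrite (approxP x n) modz_mod. Qed.

Definition padic_trunc (f : nat -> int) (n : nat) : int := (f n %% (val v ^ n)%N%:Z)%Z.

Lemma padic_truncP (f : nat -> int) :
    (forall n, (f n.+1 = f n %[mod (val v ^ n)%N%:Z])%Z) ->
  forall n, padic_trunc f n = (padic_trunc f n.+1 %% (val v ^ n)%N%:Z)%Z.
Proof. by move=> hf n; rewrite /padic_trunc -/p modz_qS; exact/esym/hf. Qed.

Definition padic_of (f : nat -> int)
    (hf : forall n, (f n.+1 = f n %[mod (val v ^ n)%N%:Z])%Z) : padic_int :=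
  PadicInt (padic_truncP hf).

Lemma approxS (x : padic_int) n : (x n.+1 = x n %[mod q n])%Z.
Proof. by rewrite [in RHS](approxP x n) modz_mod. Qed.

Fact padic_zero_subproof n : ((0 : int) = 0 %[mod (val v ^ n)%N%:Z])%Z.
Proof. by []. Qed.
Fact padic_one_subproof n : ((1 : int) = 1 %[mod (val v ^ n)%N%:Z])%Z.
Proof. by []. Qed.
Fact padic_opp_subproof (x : padic_int) n :
  (- x n.+1 = - x n %[mod (val v ^ n)%N%:Z])%Z.
Proof. by rewrite -modzNm (approxS x n) modzNm. Qed.
Fact padic_add_subproof (x y : padic_int) n :
  (x n.+1 + y n.+1 = x n + y n %[mod (val v ^ n)%N%:Z])%Z.
Proof. by rewrite -modzDm (approxS x n) (approxS y n) modzDm. Qed.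
Fact padic_mul_subproof (x y : padic_int) n :
  (x n.+1 * y n.+1 = x n * y n %[mod (val v ^ n)%N%:Z])%Z.
Proof. by rewrite -modzMm (approxS x n) (approxS y n) modzMm. Qed.

Definition padic_zero := @padic_of (fun=> 0) padic_zero_subproof.
Definition padic_one := @padic_of (fun=> 1) padic_one_subproof.
Definition padic_opp x := padic_of (padic_opp_subproof x).
Definition padic_add x y := padic_of (padic_add_subproof x y).
Definition padic_mul x y := padic_of (padic_mul_subproof x y).

Fact padic_addA : associative padic_add.
Proof.
by move=> x y z; apply: padic_intP => n /=; rewrite /padic_trunc/= modzDmr modzDml addrA.
Qed.
Fact padic_addC : commutative padic_add.
Proof. by move=> x y; apply: padic_intP => n /=; rewrite /padic_trunc addrC. Qed.
Fact padic_add0 : left_id padic_zero padic_add.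
Proof.
by move=> x; apply: padic_intP => n; rewrite /= /padic_trunc/= mod0z add0r approx_mod.
Qed.
Fact padic_addN : left_inverse padic_zero padic_opp padic_add.
Proof.
by move=> x; apply: padic_intP => n; rewrite /= /padic_trunc/= modzDml addNr.
Qed.

HB.instance Definition _ := GRing.isZmodule.Build padic_int
  padic_addA padic_addC padic_add0 padic_addN.

Fact padic_mulA : associative padic_mul.
Proof.
by move=> x y z; apply: padic_intP => n /=; rewrite /padic_trunc/= modzMmr modzMml mulrA.
Qed.
Fact padic_mulC : commutative padic_mul.
Proof. by move=> x y; apply: padic_intP => n /=; rewrite /padic_trunc mulrC. Qed.
Fact padic_mul1 : left_id padic_one padic_mul.
Proof.
by move=> x; apply: padic_intP => n; rewrite /= /padic_trunc/= modzMml mul1r approx_mod.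
Qed.
Fact padic_mulD : left_distributive padic_mul padic_add.
Proof.
move=> x y z; apply: padic_intP => n.
by rewrite /= /padic_trunc/= modzMml modzDm mulrDl.
Qed.
Fact padic_one_neq0 : padic_one != padic_zero.
Proof.
apply/eqP => /(congr1 (fun x : padic_int => x 1%N)).
rewrite /= /padic_trunc mod0z modz_small ?ltz_nat //= expn1.
exact: place_gt1.
Qed.

HB.instance Definition _ := GRing.Zmodule_isComNzRing.Build padic_int
  padic_mulA padic_mulC padic_mul1 padic_mulD padic_one_neq0.

Definition padic_unit : pred padic_int := fun x => `[< exists y, y * x = 1 >].
Definition padic_inv (x : padic_int) : padic_int :=
  if pselect (exists y, y * x = 1) is left e then projT1 (cid e) else x.

Fact padic_mulVx : {in padic_unit, left_inverse 1 padic_inv *%R}.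
Proof.
move=> x /asboolP hx; rewrite /padic_inv; case: pselect => // e.
exact: (projT2 (cid e)).
Qed.
Fact padic_unitP (x y : padic_int) : y * x = 1 -> padic_unit x.
Proof. by move=> yx; apply/asboolP; exists y. Qed.
Fact padic_inv_out : {in [predC padic_unit], padic_inv =1 id}.
Proof.
move=> x /asboolP hx; rewrite /padic_inv; case: pselect => // e.
Qed.

HB.instance Definition _ := GRing.ComNzRing_hasMulInverse.Build padic_int
  padic_mulVx padic_unitP padic_inv_out.

Lemma approx_modD (x : padic_int) m k : (x (m + k)%N %% q m)%Z = x m.
Proof.
elim: k => [|k IHk]; first by rewrite addn0 approx_mod.
rewrite addnS -[RHS]IHk [in RHS](approxP x (m + k)%N).
have -> : (val v ^ (m + k))%N%:Z = q k * q m by rewrite /q mulrC -PoszM -expnD.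
rewrite [in LHS](divz_eq (x (m + k).+1) (q k * q m)).
by rewrite mulrA modzMDl.
Qed.

Fact padic_idomain (x y : padic_int) : x * y = 0 -> (x == 0) || (y == 0).
Proof.
have nz (z : padic_int) : z != 0 -> exists m, z m != 0.
  move=> z0; apply: contrapT => h; move/eqP: z0; apply; apply: padic_intP => n.
  rewrite /= /padic_trunc mod0z; apply: contrapT => zn.
  by apply: h; exists n; exact/eqP.
move=> xy; apply: contrapT => /negP; rewrite negb_or => /andP[/nz[m xm] /nz[k yk]].
have pr : prime p := valP v.
move: xm yk; rewrite -(approx_modD x m k) -(approx_modD y k m) (addnC k m).
move: (congr1 (fun z : padic_int => z (m + k)%N) xy).
rewrite /= /padic_trunc mod0z => /eqP.
have dE (d m' : int) : ((m' %% d)%Z == 0) = (`|d| %| `|m'|)%N.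
  by rewrite -dvdzE; apply/idP/dvdz_mod0P => /eqP.
rewrite !dE abszM /q !absz_nat.
set a := `|x _|%N; set b := `|y _|%N => hab ha hb.
have a0 : (0 < a)%N by case: (posnP a) ha => // ->; rewrite dvdn0.
have b0 : (0 < b)%N by case: (posnP b) hb => // ->; rewrite dvdn0.
move: hab ha hb; rewrite !(@pfactor_dvdn p _ _ pr) ?muln_gt0 ?a0 //.
rewrite lognM // -!ltnNge => hab ha hb.
by have := leq_trans hab (leq_add (ltnW ha) (ltnW hb)); lia.
Qed.

HB.instance Definition _ := GRing.ComUnitRing_isIntegral.Build padic_int
  padic_idomain.

Definition padic_reduction (x : padic_int) : 'F_(val v) := (approx x 1)%:~R.

End PadicIntegers.

Definition padic (v : finite_place) := {fraction (padic_int v)}.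

(* E : y^2 = x^3 + a4 x + a6 with a4, a6 : int; [ecpoint K a4 a6] is E(K).     *)
Definition discriminant (a4 a6 : int) : int :=
  - 16%:Z * (4%:Z * a4 ^+ 3 + 27%:Z * a6 ^+ 2).

Definition is_elliptic_curve (a4 a6 : int) : Prop := discriminant a4 a6 != 0.

Section Points.
Variables (K : fieldType) (a4 a6 : int).
Local Notation a := (a4%:~R : K).
Local Notation b := (a6%:~R : K).

(* [None] is the point at infinity, the identity of the group. *)
Definition on_curve (P : option (K * K)) : bool :=
  if P is Some (x, y) then y ^+ 2 == x ^+ 3 + a * x + b else true.

Record ecpoint := ECPoint { coords :> option (K * K); _ : on_curve coords }.

HB.instance Definition _ := [isSub for coords].
HB.instance Definition _ := [Choice of ecpoint by <:].

Definition ec_zero : ecpoint := @ECPoint None isT.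

Definition opp_coords (P : option (K * K)) : option (K * K) :=
  if P is Some (x, y) then Some (x, - y) else None.

Definition slope (x1 y1 x2 y2 : K) : K :=
  if x1 == x2 then (3%:R * x1 ^+ 2 + a) / (2%:R * y1) else (y2 - y1) / (x2 - x1).

(* The chord-and-tangent law.  When x1 = x2 and y1 <> - y2, the two points     *)
(* coincide and y1 <> 0.                                                       *)
Definition add_coords (P Q : option (K * K)) : option (K * K) :=
  match P, Q with
  | None, _ => Q
  | _, None => P
  | Some (x1, y1), Some (x2, y2) =>
      if (x1 == x2) && (y1 == - y2) then None
      else let l := slope x1 y1 x2 y2 in
           let x3 := l ^+ 2 - x1 - x2 in
           Some (x3, l * (x1 - x3) - y1)
  end.

Lemma on_curve_opp P : on_curve P -> on_curve (opp_coords P).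
Proof. by case: P => [[x y]|] //=; rewrite sqrrN. Qed.

Lemma on_curve_add P Q :
  on_curve P -> on_curve Q -> on_curve (add_coords P Q).
Proof.
case: P Q => [[x1 y1]|] [[x2 y2]|] //= /eqP e1 /eqP e2.
case: ifPn => //= hn; apply/eqP; rewrite /slope.
have [ex|nx] := eqVneq x1 x2.
  have ey : y1 = y2.
    move: hn; rewrite ex eqxx /= -addr_eq0 => hn.
    have /eqP : (y1 - y2) * (y1 + y2) = 0 by rewrite -subr_sqr e1 e2 ex subrr.
    by rewrite mulf_eq0 (negPf hn) orbF subr_eq0 => /eqP.
  move: hn; rewrite -ex -ey eqxx /= -addr_eq0 -mulr2n -[y1 *+ 2]mulr_natl => hn.
  set l := _ / _.
  have hl : l * (2%:R * y1) = 3%:R * x1 ^+ 2 + a by rewrite /l divfK.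
  have -> : b = y1 ^+ 2 - x1 ^+ 3 - a * x1 by rewrite e1; ring.
  have -> : a = l * (2%:R * y1) - 3%:R * x1 ^+ 2 by rewrite hl; ring.
  ring.
set l := _ / _.
have hx : x2 - x1 != 0 by rewrite subr_eq0 eq_sym.
have hl : y2 = y1 + l * (x2 - x1) by rewrite /l divfK // addrC subrK.
have eb : b = y1 ^+ 2 - x1 ^+ 3 - a * x1 by rewrite e1; ring.
have ea : a = 2%:R * l * y1 + l ^+ 2 * (x2 - x1) - (x1 ^+ 2 + x1 * x2 + x2 ^+ 2).
  apply: (mulIf hx).
  have -> : a * (x2 - x1) = y2 ^+ 2 - y1 ^+ 2 - (x2 ^+ 3 - x1 ^+ 3).
    by rewrite e1 e2; ring.
  by rewrite hl; ring.
by rewrite eb ea; ring.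
Qed.

Lemma on_curve_coords (P : ecpoint) : on_curve P. Proof. exact: valP P. Qed.

Definition ec_opp (P : ecpoint) : ecpoint :=
  ECPoint (on_curve_opp (on_curve_coords P)).

Definition ec_add (P Q : ecpoint) : ecpoint :=
  ECPoint (on_curve_add (on_curve_coords P) (on_curve_coords Q)).

Definition ec_muln (P : ecpoint) (n : nat) : ecpoint := iter n (ec_add P) ec_zero.

Definition ec_mulz (P : ecpoint) (z : int) : ecpoint :=
  match z with
  | Posz n => ec_muln P n
  | Negz n => ec_opp (ec_muln P n.+1)
  end.

(* [X : Y : Z] are homogeneous coordinates of P in the projective plane. *)
Definition homogeneous_coords (P : ecpoint) (X Y Z : K) : Prop :=
  match coords P with
  | None => [/\ X = 0, Y != 0 & Z = 0]
  | Some (x, y) => [/\ Z != 0, X = x * Z & Y = y * Z]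
  end.

(* The partial derivatives of Y^2 Z - X^3 - a4 X Z^2 - a6 Z^3. *)
Definition nonsingular_at (X Y Z : K) : Prop :=
  ~ [/\ 3%:R * X ^+ 2 + a * Z ^+ 2 = 0, 2%:R * Y * Z = 0
      & Y ^+ 2 - 2%:R * a * X * Z - 3%:R * b * Z ^+ 2 = 0].

Definition independent (r : nat) (P : 'I_r -> ecpoint) : Prop :=
  forall c : 'I_r -> int,
    \big[ec_add/ec_zero]_(i < r) ec_mulz (P i) (c i) = ec_zero ->
    forall i, c i = 0.

End Points.

(* The rank of E(K) is the largest size of a Z-independent family. *)
Definition has_positive_rank (K : fieldType) (a4 a6 : int) : Prop :=
  exists2 r : nat, (0 < r)%N & exists P : 'I_r -> ecpoint K a4 a6, independent P.

(* Reduction, E_0 and the Tamagawa number are taken with respect to the given  *)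
(* equation, which need not be minimal.                                        *)
Section Tamagawa.
Variables (v : finite_place) (a4 a6 : int).

Definition bad_reduction : Prop := (discriminant a4 a6)%:~R = 0 :> 'F_(val v).

Definition padic_to_frac (x : padic_int v) : padic v := @FracField.tofrac _ x.

(* The reduction of P is the reduction of a triple of homogeneous coordinates  *)
(* in Z_p which are not all divisible by p.                                    *)
Definition E0 : set (ecpoint (padic v) a4 a6) := [set P |
  exists X Y Z : padic_int v,
    [/\ homogeneous_coords P (padic_to_frac X) (padic_to_frac Y) (padic_to_frac Z),
        ~ [/\ padic_reduction X = 0, padic_reduction Y = 0 & padic_reduction Z = 0]
      & nonsingular_at a4 a6
          (padic_reduction X) (padic_reduction Y) (padic_reduction Z)]].

Definition E0_coset (P : ecpoint (padic v) a4 a6) :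
  set (ecpoint (padic v) a4 a6) := [set ec_add P Q | Q in E0].

Definition tamagawa_number : nat := #|` fset_set (range E0_coset) |%fset.

End Tamagawa.

(* E(R) with its topology as a subspace of the projective plane, i.e. with the *)
(* quotient topology of its cone of homogeneous coordinates in R^3 \ {0}.      *)
Definition real_points (R : realType) (a4 a6 : int) : Type := ecpoint R a4 a6.

Section RealTopology.
Variables (R : realType) (a4 a6 : int).
Local Notation T := (real_points R a4 a6).

HB.instance Definition _ := Choice.on T.

Definition real_points_open (U : set T) : Prop :=
  exists2 W : set (R * R * R), open W &
    forall (P : T) (X Y Z : R), homogeneous_coords P X Y Z -> (W (X, Y, Z) <-> U P).

Lemma real_points_openT : real_points_open setT.
Proof. by exists setT => //; exact: openT. Qed.

Lemma real_points_openI : setI_closed real_points_open.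
Proof.
move=> U V [W1 o1 h1] [W2 o2 h2]; exists (W1 `&` W2); first exact: openI.
by move=> P X Y Z hP; split=> -[]; split; [exact/(h1 _ _ _ _ hP)|
  exact/(h2 _ _ _ _ hP)|exact/(h1 _ _ _ _ hP)|exact/(h2 _ _ _ _ hP)].
Qed.

Lemma real_points_open_bigU (I : Type) (f : I -> set T) :
  (forall i, real_points_open (f i)) -> real_points_open (\bigcup_i f i).
Proof.
move=> hf; pose adapted (i : I) (W : set (R * R * R)) := open W /\
  forall (P : T) (X Y Z : R), homogeneous_coords P X Y Z -> (W (X, Y, Z) <-> f i P).
exists (\bigcup_(W in [set W | exists i, adapted i W]) W).
  by apply: bigcup_open => W [i []].
move=> P X Y Z hP; split.
  by move=> [W [i [_ hW]] WP]; exists i => //; exact/(hW _ _ _ _ hP).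
move=> [i _ fP]; have [W oW hW] := hf i.
by exists W; [exists i|exact/(hW _ _ _ _ hP)].
Qed.

HB.instance Definition _ := isOpenTopological.Build T
  real_points_openT real_points_openI real_points_open_bigU.

Definition has_n_components (n : nat) : Prop :=
  (range (connected_component [set: T]) #= `I_n)%card.

End RealTopology.

Section Heights.
Variables (R : realType) (a4 a6 : int).
Local Notation EQ := (ecpoint rat a4 a6).

(* If x(P) = A / C^2 in lowest terms then A = numq x and C^2 = denq x. *)
Definition naive_height (P : EQ) : nat :=
  if coords P is Some (x, _) then maxn `|numq x|%N `|denq x|%N else 1%N.

Lemma naive_heightE (P : EQ) (x y : rat) (A C : int) :
    coords P = Some (x, y) -> C != 0 -> coprimez A C ->
    x = A%:~R / (C ^+ 2)%:~R ->
  naive_height P = maxn `|A|%N `|C ^+ 2|%N.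
Proof.
move=> eP C0 cop ex; rewrite /naive_height eP ex.
have C2 : 0 < C ^+ 2 by rewrite exprn_even_gt0.
have cop2 : coprime `|A| `|C ^+ 2| by rewrite abszX coprimeXr.
by rewrite coprimeq_num // coprimeq_den // gtr0_sg // mul1r gt_eqF // abszE.
Qed.

Definition log_height (P : EQ) : R := ln (naive_height P)%:R.

Definition canonical_height (P : EQ) : R :=
  2^-1 * limn (fun n : nat => log_height (ec_muln P n) / n%:R ^+ 2).

End Heights.

(* Main.v *)
Require Import Defs.
From HB Require Import structures.
From mathcomp Require Import all_boot all_order all_algebra.
From mathcomp Require Import ring lra zify.
From mathcomp Require Import finmap.
From mathcomp Require Import all_classical all_reals all_analysis.

Set Implicit Arguments.
Unset Strict Implicit.
Unset Printing Implicit Defensive.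

Import Order.TTheory GRing.Theory Num.Theory.
Import numFieldNormedType.Exports.

Local Open Scope classical_set_scope.
Local Open Scope ring_scope.

(* Write x(P) = A/D in lowest terms, f = x^3 + a4 x + a6 and                      *)
(* N = x^4 - 2 a4 x^2 - 8 a6 x + a4^2, so that x(2P) = N / (4f).  A prime p        *)
(* dividing both D^4 N and 4 D^4 f makes P singular modulo p, which c_p = 1        *)
(* excludes; hence there is no cancellation and H(2P) = D^4 max(N, 4f).  The       *)
(* hypothesis on 2 a4 x^2 + 8 a6 x - a4^2 says N >= x^4 on E(R), and for |x| < 1   *)
(* one checks N >= 1 or 4f >= 1 case by case.  Two curves escape: on               *)
(* y^2 = x^3 - 2x + 1 the point (0, 1) is singular modulo 2, and                   *)
(* y^2 = x^3 - 2x - 1 has no affine rational point but (-1, 0), by a Fermat        *)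
(* descent on M^4 - 3 M^2 e^2 + e^4 = N^2.  Thus H(2P) >= H(P)^4 for all P.  With  *)
(* the parallelogram inequality for the naive height, the limit defining the       *)
(* canonical height exists, and it is at least h_W(P)/2 along n = 2^k.             *)

(** * The group law *)

(** The theorem follows from quartic growth under doubling. If [H(2P) >= H(P)^4] for every rational
    point, then [h_W(2^k P) / 4^k] is nondecreasing in k. Its first term [h_W(P)] is therefore at
    most its limit, which is twice the canonical height.

    Growth has an arithmetic and a real input. By [tamagawa1_E0] the condition c_p = 1 puts all of
    E(Q_p) in E_0, so no rational point reduces to the singular point ([E0_not_singular]). A prime
    common to the integers [dup_num] and [dup_den] that represent x(2P) would produce such a
    reduction ([singular_reduction]), whence [coprime_duplication]. [dup_bound] then bounds the
    larger of the two from below. Both parts of the theorem reach it through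
    [canonical_height_ge_region], because the cubic is positive only on the intervals named in the
    hypotheses.

    The canonical height is a [limn], so convergence along all n has to be proved.
    [parallelogram_le] bounds [H(P+Q) H(P-Q)] from above, and [quasi_quadratic_lim] combines it with
    the growth under doubling. Applying this to the multiples nP requires associativity, [ec_addA],
    obtained from explicit slopes. *)

(** Chords and tangents satisfy the same two polynomial equations, so later identities need no case
    distinction. The second is the difference of the two curve equations divided by x2 - x1, and it
    remains true for a tangent. *)
Lemma slopeP (K : fieldType) (a4 a6 : int) (x1 y1 x2 y2 : K) :
    on_curve a4 a6 (Some (x1, y1)) -> on_curve a4 a6 (Some (x2, y2)) ->
    ~~ ((x1 == x2) && (y1 == - y2)) ->
  let s := slope a4 x1 y1 x2 y2 in
  s * (x2 - x1) = y2 - y1 /\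
  s * (y1 + y2) = x1 ^+ 2 + x1 * x2 + x2 ^+ 2 + a4%:~R.
Proof.
move=> /eqP e1 /eqP e2 hn; rewrite /slope.
have [ex|nx] := eqVneq x1 x2.
  have ey : y1 = y2.
    move: hn; rewrite ex eqxx /= -addr_eq0 => hn.
    have /eqP : (y1 - y2) * (y1 + y2) = 0 by rewrite -subr_sqr e1 e2 ex subrr.
    by rewrite mulf_eq0 (negPf hn) orbF subr_eq0 => /eqP.
  move: hn; rewrite -ex -ey eqxx /= -addr_eq0 -mulr2n -[y1 *+ 2]mulr_natl => hn.
  by rewrite !subrr mulr0; split=> //; rewrite divfK //; ring.
have hx : x2 - x1 != 0 by rewrite subr_eq0 eq_sym.
split; first by rewrite divfK.
apply: (mulfI hx); rewrite mulrA mulrCA divff // mulr1.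
transitivity (y2 ^+ 2 - y1 ^+ 2); first by ring.
by rewrite e1 e2; ring.
Qed.

Lemma add_coordsE (K : fieldType) (a4 : int) (x1 y1 x2 y2 s : K) :
    ~~ ((x1 == x2) && (y1 == - y2)) ->
    s = slope a4 x1 y1 x2 y2 ->
  add_coords a4 (Some (x1, y1)) (Some (x2, y2)) =
  Some (s ^+ 2 - x1 - x2, s * (x1 - (s ^+ 2 - x1 - x2)) - y1).
Proof. by move=> /negPf hn ->; rewrite /add_coords hn. Qed.

(** One of the coefficients x2 - x1 and y1 + y2 is nonzero, so the corresponding equation determines
    s. *)
Lemma slope_uniq (K : fieldType) (a4 a6 : int) (x1 y1 x2 y2 s : K) :
    on_curve a4 a6 (Some (x1, y1)) -> on_curve a4 a6 (Some (x2, y2)) ->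
    ~~ ((x1 == x2) && (y1 == - y2)) ->
    s * (x2 - x1) = y2 - y1 ->
    s * (y1 + y2) = x1 ^+ 2 + x1 * x2 + x2 ^+ 2 + a4%:~R ->
  s = slope a4 x1 y1 x2 y2.
Proof.
move=> o1 o2 hn h1 h2; have [k1 k2] := slopeP o1 o2 hn.
move: hn; rewrite negb_and => /orP[hx|hy].
  have hx' : x2 - x1 != 0 by rewrite subr_eq0 eq_sym.
  by apply: (mulIf hx'); rewrite h1 k1.
by rewrite -addr_eq0 in hy; apply: (mulIf hy); rewrite h2 k2.
Qed.

(** Eliminating a4 and a6 turns the discriminant into a multiple of (2y)^2. Writing 2y = 0 rather
    than y = 0 gives the partial derivative in every characteristic. *)
Lemma nonsingular_point (K : fieldType) (a4 a6 : int) (x y : K) :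
    (discriminant a4 a6)%:~R != 0 :> K -> on_curve a4 a6 (Some (x, y)) ->
  2%:R * y = 0 -> 3%:R * x ^+ 2 + a4%:~R != 0.
Proof.
move=> hd /eqP o hy; apply: contraNneq hd => hx.
have eb : a6%:~R = y ^+ 2 - x ^+ 3 - a4%:~R * x by rewrite o; ring.
have ea : a4%:~R = - (3%:R * x ^+ 2) :> K.
  by apply/eqP; rewrite -addr_eq0 addrC hx.
rewrite /discriminant; rewrite !(rmorphM, rmorphN, rmorphD, rmorphXn) /=.
rewrite eb ea; apply/eqP.
transitivity (- 4%:R * 27%:R * (4%:R * x ^+ 3 + y ^+ 2) * (2%:R * y) ^+ 2).
  by ring.
by rewrite hy; ring.
Qed.

Lemma add_coordsC (K : fieldType) (a4 a6 : int) (P Q : option (K * K)) :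
  on_curve a4 a6 P -> on_curve a4 a6 Q -> add_coords a4 P Q = add_coords a4 Q P.
Proof.
case: P Q => [[x1 y1]|] [[x2 y2]|] // o1 o2.
have [/andP[/eqP ex /eqP ey]|hn] := boolP ((x1 == x2) && (y1 == - y2)).
  by rewrite /= ex ey opprK !eqxx.
have hn' : ~~ ((x2 == x1) && (y2 == - y1)) by rewrite (eq_sym x2) (eq_sym y2) eqr_oppLR.
have [k1 k2] := slopeP o1 o2 hn.
set s := slope _ _ _ _ _ in k1 k2.
have -> := add_coordsE hn (erefl s).
have -> : add_coords a4 (Some (x2, y2)) (Some (x1, y1)) =
    Some (s ^+ 2 - x2 - x1, s * (x2 - (s ^+ 2 - x2 - x1)) - y2).
  apply: add_coordsE => //; apply: (slope_uniq o2 o1 hn').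
    by rewrite -[RHS]opprB -k1; ring.
  by rewrite addrC k2; ring.
congr (Some (_, _)); first by ring.
have -> : y2 = y1 + s * (x2 - x1) by rewrite k1; ring.
by ring.
Qed.

(* The line through P and Q also passes through -(P+Q). *)
Lemma add_coordsK (K : fieldType) (a4 a6 : int) (P Q : option (K * K)) :
    (discriminant a4 a6)%:~R != 0 :> K ->
    on_curve a4 a6 P -> on_curve a4 a6 Q ->
  add_coords a4 (opp_coords P) (add_coords a4 P Q) = Q.
Proof.
move=> hd; case: P => [[x1 y1]|]; last by case: Q => [[]|].
move=> o1; have o1' := on_curve_opp o1.
case: Q => [[x2 y2]|] o2; last by rewrite /= !eqxx.
have [/andP[/eqP ex /eqP ey]|hn] := boolP ((x1 == x2) && (y1 == - y2)).
  by rewrite /= ex ey !eqxx /= opprK.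
have [k1 k2] := slopeP o1 o2 hn.
set s := slope _ _ _ _ _ in k1 k2.
rewrite (add_coordsE hn (erefl s)).
set x3 := s ^+ 2 - x1 - x2; set y3 := s * (x1 - x3) - y1.
have o3 : on_curve a4 a6 (Some (x3, y3)).
  by have := on_curve_add o1 o2; rewrite (add_coordsE hn (erefl s)).
have y2E : y2 = y1 + s * (x2 - x1) by rewrite k1; ring.
have line : - s * (- y1 + y3) = x1 ^+ 2 + x1 * x3 + x3 ^+ 2 + a4%:~R.
  have -> : a4%:~R = s * (y1 + y2) - (x1 ^+ 2 + x1 * x2 + x2 ^+ 2) by rewrite k2; ring.
  by rewrite y2E /y3 /x3; ring.
have hn3 : ~~ ((x1 == x3) && (- y1 == - y3)).
  apply/negP => /andP[/eqP ex /eqP/oppr_inj ey].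
  have hy : 2%:R * y1 = 0.
    by rewrite mulr_natl mulr2n [X in _ + X]ey /y3 -ex; ring.
  have := nonsingular_point hd o1 hy; apply/negP; rewrite negbK; apply/eqP.
  by transitivity (- s * (- y1 + y3)); [rewrite line -ex; ring|rewrite -ey; ring].
have -> : add_coords a4 (opp_coords (Some (x1, y1))) (Some (x3, y3)) =
    Some ((- s) ^+ 2 - x1 - x3, (- s) * (x1 - ((- s) ^+ 2 - x1 - x3)) - - y1).
  apply: add_coordsE => //; apply: (slope_uniq o1' o3 hn3) => //.
  by rewrite /y3; ring.
have -> : (- s) ^+ 2 - x1 - x3 = x2 by rewrite /x3; ring.
by rewrite y2E; congr (Some (_, _)); ring.
Qed.

(** Here l and n are the slopes of PQ and QR, and (x4, y4) is P + Q. The slope of the line through P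
    + Q and R is a rational function of them whose denominator n - l vanishes when P, Q, R are
    collinear. [E1] and [E2] are the defects of the two slope equations; both claims are linear
    combinations of them. *)
Lemma assoc_slope (K : fieldType) (a x1 y1 x2 y2 x3 y3 l n x4 y4 : K) :
    l * (x2 - x1) = y2 - y1 -> l * (y1 + y2) = x1 ^+ 2 + x1 * x2 + x2 ^+ 2 + a ->
    n * (x3 - x2) = y3 - y2 -> n * (y2 + y3) = x2 ^+ 2 + x2 * x3 + x3 ^+ 2 + a ->
    x4 = l ^+ 2 - x1 - x2 -> y4 = l * (x1 - x4) - y1 -> n != l ->
  let s := (x2 + x3 + x4 - l * n) / (n - l) in
  s * (x3 - x4) = y3 - y4 /\
  s * (y4 + y3) = x4 ^+ 2 + x4 * x3 + x3 ^+ 2 + a.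
Proof.
move=> l1 l2 n1 n2 e4 f4 hnl s.
have d0 : n - l != 0 by rewrite subr_eq0.
have sE : s * (n - l) = x2 + x3 + x4 - l * n by rewrite divfK.
have y1E : y1 = y2 - l * (x2 - x1) by rewrite l1; ring.
have y3E : y3 = y2 + n * (x3 - x2) by rewrite n1; ring.
pose E1 := l * (y1 + y2) - (x1 ^+ 2 + x1 * x2 + x2 ^+ 2 + a).
pose E2 := n * (y2 + y3) - (x2 ^+ 2 + x2 * x3 + x3 ^+ 2 + a).
have E10 : E1 = 0 by rewrite /E1 l2 subrr.
have E20 : E2 = 0 by rewrite /E2 n2 subrr.
split; apply: (mulIf d0).
  rewrite mulrAC sE; apply/eqP; rewrite -subr_eq0.
  have -> : (x2 + x3 + x4 - l * n) * (x3 - x4) - (y3 - y4) * (n - l) = E1 - E2.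
    by rewrite /E1 /E2 f4 e4 y1E y3E; ring.
  by rewrite E10 E20 subrr.
rewrite mulrAC sE; apply/eqP; rewrite -subr_eq0.
have -> : (x2 + x3 + x4 - l * n) * (y4 + y3) -
    (x4 ^+ 2 + x4 * x3 + x3 ^+ 2 + a) * (n - l) = n * E1 - l * E2.
  by rewrite /E1 /E2 f4 e4 y1E y3E; ring.
by rewrite E10 E20 !mulr0 subrr.
Qed.

Lemma add_coordsA_generic (K : fieldType) (a4 a6 : int) (x1 y1 x2 y2 x3 y3 : K) :
    let P := Some (x1, y1) in let Q := Some (x2, y2) in let R := Some (x3, y3) in
    on_curve a4 a6 P -> on_curve a4 a6 Q -> on_curve a4 a6 R ->
    P <> opp_coords Q -> Q <> opp_coords R ->
    add_coords a4 P Q <> opp_coords R -> P <> opp_coords (add_coords a4 Q R) ->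
    slope a4 x1 y1 x2 y2 != slope a4 x2 y2 x3 y3 ->
  add_coords a4 (add_coords a4 P Q) R = add_coords a4 P (add_coords a4 Q R).
Proof.
move=> P Q R oP oQ oR PQ QR PQR PQR' hln.
have neg (u1 v1 u2 v2 : K) : Some (u1, v1) <> opp_coords (Some (u2, v2)) ->
    ~~ ((u1 == u2) && (v1 == - v2)).
  by move=> h; apply/negP => /andP[/eqP e1 /eqP e2]; apply: h; rewrite e1 e2.
have hPQ := neg _ _ _ _ PQ; have hQR := neg _ _ _ _ QR.
have [l1 l2] := slopeP oP oQ hPQ; have [n1 n2] := slopeP oQ oR hQR.
set l := slope _ x1 _ _ _ in hln l1 l2; set n := slope _ x2 _ _ _ in hln n1 n2.
have oS := on_curve_add oP oQ; have oT := on_curve_add oQ oR.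
move: oS oT PQR PQR'.
rewrite (add_coordsE hPQ (erefl l)) (add_coordsE hQR (erefl n)).
set x4 := l ^+ 2 - x1 - x2; set y4 := l * (x1 - x4) - y1.
set x5 := n ^+ 2 - x2 - x3; set y5 := n * (x2 - x5) - y2.
move=> oS oT PQR PQR'.
have hSR := neg _ _ _ _ PQR; have hPT := neg _ _ _ _ PQR'.
have nl : n != l by rewrite eq_sym.
have [s1 s2] := assoc_slope l1 l2 n1 n2 (erefl x4) (erefl y4) nl.
(* The same formula for the reversed triple R, Q, P gives the slope r used in P + (Q + R); it equals
   s - (n - l). *)
have [] := @assoc_slope K a4%:~R x3 y3 x2 y2 x1 y1 n l x5 y5 _ _ _ _ _ _ hln.
- by rewrite -[RHS]opprB -n1; ring.
- by rewrite addrC n2; ring.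
- by rewrite -[RHS]opprB -l1; ring.
- by rewrite addrC l2; ring.
- by rewrite /x5; ring.
- have -> : y3 = y2 + n * (x3 - x2) by rewrite n1; ring.
  by rewrite /y5; ring.
have d0 : n - l != 0 by rewrite subr_eq0.
have d0' : l - n != 0 by rewrite subr_eq0.
set s := (_ / (n - l)) in s1 s2; set r := (_ / (l - n)) => r1 r2.
have sE := slope_uniq oS oR hSR s1 s2.
have rE : r = slope a4 x1 y1 x5 y5.
  apply: (slope_uniq oP oT hPT); first by rewrite -[RHS]opprB -r1; ring.
  by rewrite addrC r2; ring.
rewrite (add_coordsE hSR sE) (add_coordsE hPT rE).
have rsE : r = s - (n - l).
  rewrite /r /s /x4 /x5; field.
  by rewrite d0 d0'.
have sd : s * (n - l) = x2 + x3 + x4 - l * n by rewrite divfK.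
have ex : s ^+ 2 - x4 - x3 = r ^+ 2 - x1 - x5.
  have -> : r ^+ 2 = s ^+ 2 - 2%:R * (s * (n - l)) + (n - l) ^+ 2 by rewrite rsE; ring.
  by rewrite sd /x4 /x5; ring.
rewrite -ex; congr (Some (_, _)).
have l1' : y1 = y2 - l * (x2 - x1) by rewrite l1; ring.
have r3 : y3 = y2 + n * (x3 - x2) by rewrite n1; ring.
set X := _ - x4 - x3; apply: (mulIf d0); apply/eqP; rewrite -subr_eq0 rsE.
have -> : (s * (x4 - X) - y4) * (n - l) - ((s - (n - l)) * (x1 - X) - y1) * (n - l) =
    s * (n - l) * (x4 - x1) + (n - l) * ((n - l) * (x1 + x4 + x3) + y1 - y4) - (s * (n - l)) ^+ 2.
  by rewrite /X; ring.
rewrite sd.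
have -> : 0 = (n * (y2 + y3) - (x2 ^+ 2 + x2 * x3 + x3 ^+ 2 + a4%:~R)) -
  (l * (y1 + y2) - (x1 ^+ 2 + x1 * x2 + x2 ^+ 2 + a4%:~R)) by rewrite n2 l2; ring.
by apply/eqP; rewrite /y4 l1' r3 /x4; ring.
Qed.

Lemma ec_eqP (K : fieldType) (a4 a6 : int) (P Q : ecpoint K a4 a6) :
  coords P = coords Q -> P = Q.
Proof. exact: val_inj. Qed.

Lemma ec_addC (K : fieldType) (a4 a6 : int) (P Q : ecpoint K a4 a6) :
  ec_add P Q = ec_add Q P.
Proof.
by apply: ec_eqP; exact: (add_coordsC (on_curve_coords P) (on_curve_coords Q)).
Qed.

Lemma ec_add0 (K : fieldType) (a4 a6 : int) (P : ecpoint K a4 a6) :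
  ec_add (ec_zero K a4 a6) P = P.
Proof. exact: ec_eqP. Qed.

Lemma ec_addr0 (K : fieldType) (a4 a6 : int) (P : ecpoint K a4 a6) :
  ec_add P (ec_zero K a4 a6) = P.
Proof. by rewrite ec_addC ec_add0. Qed.

Lemma ec_oppK (K : fieldType) (a4 a6 : int) (P : ecpoint K a4 a6) :
  ec_opp (ec_opp P) = P.
Proof. by apply: ec_eqP; case: P => -[[x y]|] o //=; rewrite opprK. Qed.

Lemma ec_addN (K : fieldType) (a4 a6 : int) (P : ecpoint K a4 a6) :
  ec_add P (ec_opp P) = ec_zero K a4 a6.
Proof. by apply: ec_eqP; case: P => -[[x y]|] o //=; rewrite opprK !eqxx. Qed.

Lemma ec_addK (K : fieldType) (a4 a6 : int) (P Q : ecpoint K a4 a6) :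
    (discriminant a4 a6)%:~R != 0 :> K ->
  ec_add (ec_opp P) (ec_add P Q) = Q.
Proof.
move=> hd; apply: ec_eqP.
exact: (add_coordsK hd (on_curve_coords P) (on_curve_coords Q)).
Qed.

(* If P, Q, R are collinear then either R = P or R = -(P + Q). *)
Lemma ec_addA (K : fieldType) (a4 a6 : int) (P Q R : ecpoint K a4 a6) :
    (discriminant a4 a6)%:~R != 0 :> K ->
  ec_add (ec_add P Q) R = ec_add P (ec_add Q R).
Proof.
move=> hd; have K1 (A B : ecpoint K a4 a6) := @ec_addK _ _ _ A B hd.
have K2 (A B : ecpoint K a4 a6) : ec_add A (ec_add (ec_opp A) B) = B.
  by have := K1 (ec_opp A) B; rewrite ec_oppK.
(* The relation A + B + C = 0 is invariant under cyclic permutation, which settles the degenerate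
   sums. *)
have rot (A B C : ecpoint K a4 a6) : ec_add A B = ec_opp C -> ec_add B C = ec_opp A.
  move=> h; have <- : ec_add (ec_opp A) (ec_opp C) = B by rewrite -h K1.
  by rewrite ec_addC (ec_addC (ec_opp A)) K2.
have [->|PQ] := pselect (P = ec_opp Q).
  by rewrite (ec_addC (ec_opp Q)) ec_addN ec_add0 K1.
have [->|QR] := pselect (Q = ec_opp R).
  by rewrite (ec_addC (ec_opp R) R) ec_addN ec_addr0 ec_addC (ec_addC P) K2.
have [h|PQR] := pselect (ec_add P Q = ec_opp R).
  by rewrite (rot _ _ _ h) h ec_addN ec_addC ec_addN.
have [h|PQR'] := pselect (P = ec_opp (ec_add Q R)).
  case: PQR; have h' : ec_add Q R = ec_opp P by rewrite h ec_oppK.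
  by have /rot/rot := h'.
have [<-|RP] := pselect (P = R); first by rewrite ec_addC (ec_addC P Q).
move: PQ QR PQR PQR' RP; case: P Q R => -[[x1 y1]|] oP; last first.
  by move=> Q R *; rewrite -/(ec_zero _ _ _); apply: ec_eqP; rewrite /=.
case=> -[[x2 y2]|] oQ; last by move=> R *; apply: ec_eqP.
case=> -[[x3 y3]|] oR; last first.
  by move=> *; apply: ec_eqP => /=; case: ifP.
move=> PQ QR PQR PQR' RP; apply: ec_eqP => /=.
have ne (A B : ecpoint K a4 a6) : A <> B -> coords A <> coords B by move=> + /ec_eqP.
apply: (add_coordsA_generic oP oQ oR (ne _ _ PQ) (ne _ _ QR) (ne _ _ PQR) (ne _ _ PQR')).
apply/eqP => hl.
have neg (u1 v1 u2 v2 : K) o o' :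
    @ECPoint K a4 a6 (Some (u1, v1)) o <> ec_opp (@ECPoint K a4 a6 (Some (u2, v2)) o') ->
    ~~ ((u1 == u2) && (v1 == - v2)).
  move=> h; apply/negP => /andP[/eqP e1 /eqP e2]; apply: h; apply: ec_eqP => /=.
  by rewrite e1 e2.
have hPQ := neg _ _ _ _ _ _ PQ; have hQR := neg _ _ _ _ _ _ QR.
have [l1 l2] := slopeP oP oQ hPQ; have [n1 n2] := slopeP oQ oR hQR.
move: n1 n2; rewrite -hl; set l := slope _ x1 _ _ _ in l1 l2 * => n1 n2.
have y1E : y1 = y2 - l * (x2 - x1) by rewrite l1; ring.
have y3E : y3 = y2 + l * (x3 - x2) by rewrite n1; ring.
(* With equal slopes the three points lie on one line, whose third intersection with the curve has
   abscissa l^2 - x1 - x2. *)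
have : (x1 - x3) * (l ^+ 2 - x1 - x2 - x3) = 0.
  transitivity ((l * (y1 + y2) - (x1 ^+ 2 + x1 * x2 + x2 ^+ 2 + a4%:~R)) -
    (l * (y2 + y3) - (x2 ^+ 2 + x2 * x3 + x3 ^+ 2 + a4%:~R))).
    by rewrite y1E y3E; ring.
  by rewrite l2 n2; ring.
move/eqP; rewrite mulf_eq0 !subr_eq0 => /orP[/eqP ex|/eqP ex].
  by apply: RP; apply: ec_eqP => /=; rewrite ex y1E y3E ex; congr (Some (_, _)); ring.
apply: PQR; apply: ec_eqP; rewrite /ec_add /coords (add_coordsE hPQ (erefl l)).
rewrite ex /=; congr (Some (_, _)).
by rewrite y1E y3E; ring.
Qed.

(** * Rational points on y^2 = x^3 - 2x - 1 *)

Lemma gcdn_sqr (a c : nat) : gcdn (a ^ 2) (c ^ 2) = (gcdn a c ^ 2)%N.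
Proof.
have [->|a0] := posnP a; first by rewrite exp0n // !gcd0n.
have g0 : (0 < gcdn a c)%N by rewrite gcdn_gt0 a0.
have /dvdnP[a' ea] := dvdn_gcdl a c; have /dvdnP[c' ec] := dvdn_gcdr a c.
set g := gcdn a c in g0 ea ec *.
have cop : coprime a' c'.
  by rewrite /coprime -(eqn_pmul2r g0) mul1n muln_gcdl -ea -ec.
rewrite ea ec !expnMn -muln_gcdl.
have /eqP -> : coprime (a' ^ 2) (c' ^ 2) by rewrite coprimeXl // coprimeXr.
by rewrite mul1n.
Qed.

Lemma coprime_mul_square (a b c : nat) :
  coprime a b -> (a * b = c ^ 2)%N -> a = (gcdn a c ^ 2)%N.
Proof.
move=> cop h; rewrite -gcdn_sqr -h -mulnn -muln_gcdr.
by rewrite (eqP cop) muln1.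
Qed.

Lemma gcdn_mul_dvd (m r s : nat) :
  coprime r s -> (m %| r * s)%N -> (gcdn m r * gcdn m s = m)%N.
Proof.
move=> cop h; apply/eqP; rewrite eqn_dvd; apply/andP; split.
  rewrite Gauss_dvd ?dvdn_gcdl //.
  exact: coprime_dvdl (dvdn_gcdr _ _) (coprime_dvdr (dvdn_gcdr _ _) cop).
rewrite muln_gcdr dvdn_gcd dvdn_mull //= mulnC muln_gcdr dvdn_gcd dvdn_mull //=.
by rewrite mulnC.
Qed.

(** The common refinement of two coprime factorizations of one number, given by the pairwise
    gcds. *)
Lemma four_numbers (m n r s : nat) :
    coprime m n -> coprime r s -> (m * n = r * s)%N ->
  exists k l u v, [/\ m = (k * l)%N, n = (u * v)%N, r = (k * u)%N & s = (l * v)%N].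
Proof.
move=> mn rs h; exists (gcdn m r), (gcdn m s), (gcdn n r), (gcdn n s); split.
- by rewrite gcdn_mul_dvd // -h dvdn_mulr.
- by rewrite gcdn_mul_dvd // -h dvdn_mull.
- by rewrite !(gcdnC _ r) gcdn_mul_dvd // h dvdn_mulr.
- by rewrite !(gcdnC _ s) gcdn_mul_dvd // h dvdn_mull.
Qed.

Lemma coprime_of_dvd2 (a b c d : nat) :
    coprime c d -> (forall g, g %| a -> g %| b -> g %| c)%N ->
    (forall g, g %| a -> g %| b -> g %| d)%N -> coprime a b.
Proof.
move=> cd hc hd; rewrite /coprime -dvdn1 -(eqP cd) dvdn_gcd.
by rewrite hc ?hd ?dvdn_gcdl ?dvdn_gcdr.
Qed.

Lemma odd_pair (m n : nat) : odd m -> odd n -> (n <= m)%N ->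
  exists a b, [/\ (b <= a)%N, m = (a + b)%N, n = (a - b)%N & (m ^ 2 = n ^ 2 + 4 * (a * b))%N].
Proof.
move=> om on nm; pose b := (m - n)./2.
have mE : (m = n + b + b)%N by rewrite /b; lia.
exists (n + b)%N, b; split=> //; [exact: leq_addl|by rewrite addnK|].
by rewrite mE; clear; lia.
Qed.

(* (k - l)(k + l) = 4u^2 with coprime halves, so these are squares n^2, m^2. *)
Lemma square_pair (l u k v : nat) :
    coprime l u -> odd l -> (0 < u)%N ->
    (l ^ 2 = u ^ 2 + v ^ 2)%N -> (k ^ 2 = l ^ 2 + 4 * u ^ 2)%N ->
  exists m n, [/\ coprime m n, (m * n)%N = u & (m ^ 4 + n ^ 4 = v ^ 2 + 3 * (m * n) ^ 2)%N].
Proof.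
move=> lu ol u0 h1 h2.
have ok : odd k.
  by have : odd (k ^ 2); [rewrite h2 oddD oddM !oddX ol|rewrite oddX].
have lk : (l <= k)%N by rewrite -leq_sqr h2 leq_addr.
have [b [a [ab ka la hk]]] := odd_pair ok ol lk.
have hab : (a * b = u ^ 2)%N.
  by apply/eqP; rewrite -(eqn_pmul2l (isT : 0 < 4)%N) -(eqn_add2l (l ^ 2)) -h2 hk (mulnC b).
have cop : coprime a b.
  apply: (coprime_of_dvd2 lu) => g ga gb.
    by rewrite la dvdn_subr // ?dvdn_sub.
  by rewrite -(@dvdn_pexp2r _ _ 2) // -hab -mulnn dvdn_mul.
have ea := coprime_mul_square cop hab.
have eb : b = (gcdn b u ^ 2)%N by apply: (@coprime_mul_square b a); rewrite 1?coprime_sym // mulnC.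
set m := gcdn a u in ea; set n := gcdn b u in eb.
exists m, n; split.
- by move: cop; rewrite ea eb coprime_pexpl // coprime_pexpr.
- by apply/eqP; rewrite -(eqn_exp2r _ _ (isT : 0 < 2)%N) expnMn -ea -eb hab.
- rewrite (expnM _ 2 2) (expnM n 2 2) expnMn -ea -eb.
  have bE : b = (a + l)%N by rewrite la subnKC.
  by move: h1; rewrite -hab bE; clear; lia.
Qed.

Lemma sqr_mod4 (n : nat) : (n ^ 2 %% 4 = odd n)%N.
Proof.
rewrite -[in LHS](odd_double_half n) -muln2; set h := (n./2).
case: (odd n); rewrite ?add0n.
  by have -> : ((true + h * 2) ^ 2 = (h * h + h) * 4 + 1)%N; [rewrite /=; lia|rewrite modnMDl].
by have -> : ((h * 2) ^ 2 = (h * h) * 4)%N; [lia|rewrite modnMl].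
Qed.

(* Here (M^2 - e^2)^2 = N^2 + (Me)^2 is a primitive Pythagorean triple. *)
Lemma quartic_pythagorean (M e N : nat) :
    coprime M e -> (e < M)%N -> (M ^ 4 + e ^ 4 = N ^ 2 + 3 * (M * e) ^ 2)%N ->
  exists r s, [/\ coprime r s, (M * e = 2 * (r * s))%N & (M ^ 2 = e ^ 2 + r ^ 2 + s ^ 2)%N].
Proof.
move=> cop lt heq; pose K := (M ^ 2 - e ^ 2)%N.
have eM : (e ^ 2 < M ^ 2)%N by rewrite ltn_sqr.
have MK : (M ^ 2 = e ^ 2 + K)%N by rewrite /K subnKC; [|exact: ltnW].
have hK : (K ^ 2 = N ^ 2 + (M * e) ^ 2)%N.
  have key a k n : ((a + k) ^ 2 + a ^ 2 = n + 3 * ((a + k) * a) ->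
      k ^ 2 = n + (a + k) * a)%N by clear; lia.
  by rewrite expnMn MK; apply: key; rewrite -MK -expnMn -!expnM.
have even_Me : ~~ odd (M * e).
  (* If M and e are both odd, K is even and K^2 = N^2 + (Me)^2 fails modulo 4. *)
  rewrite oddM; apply/negP => /andP[oM oe].
  have : (K ^ 2 %% 4 = (N ^ 2 %% 4 + (M * e) ^ 2 %% 4) %% 4)%N by rewrite hK modnDm.
  rewrite !sqr_mod4 oddM oM oe.
  have -> : odd K = false by rewrite /K oddB ?(ltnW eM) // !oddX oM oe.
  by case: (odd N).
have oK : odd K.
  rewrite /K oddB ?(ltnW eM) // !oddX /=.
  move: even_Me; rewrite oddM; case oM : (odd M); case oe : (odd e) => //= _.
  have : (2 %| gcdn M e)%N by rewrite dvdn_gcd !dvdn2 oM oe.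
  by rewrite (eqP cop).
have oN : odd N.
  have : odd (K ^ 2) by rewrite oddX.
  by rewrite hK oddD !oddX (negPf even_Me) addbF.
have NK : (N <= K)%N by rewrite -leq_sqr hK leq_addr.
(* The halves (K + N)/2 and (K - N)/2 are coprime with product (Me/2)^2, so both are squares; r and
   s are their roots. *)
have [a [b [ab Ka Na hk]]] := odd_pair oK oN NK.
pose c := ((M * e) %/ 2)%N.
have cE : (M * e = 2 * c)%N by rewrite [RHS]mulnC /c divnK ?dvdn2.
have hab : (a * b = c ^ 2)%N.
  apply/eqP; rewrite -(eqn_pmul2l (isT : 0 < 4)%N) -(eqn_add2l (N ^ 2)) -hk hK cE.
  by rewrite expnMn.
have copab : coprime a b.
  have copK : coprime K (M * e).
    have c2 : coprime K (e ^ 2).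
      rewrite coprime_sym /coprime -gcdnDl -MK -/(coprime _ _).
      by rewrite coprime_pexpl // coprime_pexpr // coprime_sym.
    rewrite coprimeMr -(@coprime_pexpr 2 K M) // -(@coprime_pexpr 2 K e) // c2 andbT MK.
    by rewrite /coprime gcdnDr -/(coprime _ _).
  apply: (coprime_of_dvd2 copK) => g ga gb; first by rewrite Ka dvdn_add.
  rewrite cE dvdn_mull // -(@dvdn_pexp2r _ _ 2) // -hab -mulnn.
  exact: dvdn_mul.
have ea := coprime_mul_square copab hab.
have eb : b = (gcdn b c ^ 2)%N.
  by apply: (@coprime_mul_square b a); rewrite 1?coprime_sym // mulnC.
set m := gcdn a c in ea; set n := gcdn b c in eb.
exists m, n; split.
- by move: copab; rewrite ea eb coprime_pexpl // coprime_pexpr.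
- rewrite cE; congr (2 * _)%N; apply/eqP.
  by rewrite -(eqn_exp2r _ _ (isT : 0 < 2)%N) expnMn -ea -eb hab.
- by rewrite -ea -eb MK Ka addnA.
Qed.

(** Fermat descent on the product Me. With M = kl, e/2 = uv, r = ku, s = lv, the identity M^2 = e^2
    + r^2 + s^2 becomes k^2 (l^2 - u^2) = v^2 (l^2 + 4u^2). This splits into two conditions on
    squares, to which [square_pair] applies and yields a solution with product u or v. *)
Lemma quartic_no_solution (M e N : nat) :
    coprime M e -> (0 < M)%N -> (0 < e)%N ->
  (M ^ 4 + e ^ 4)%N <> (N ^ 2 + 3 * (M * e) ^ 2)%N.
Proof.
have [n] := ubnP (M * e)%N; elim: n M e N => // n IH M e N.
wlog lt : M e / (e < M)%N.
  move=> H hn cop M0 e0; case: (ltngtP e M) => [lt|lt|eMe]; first exact: H.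
    rewrite addnC (mulnC M); apply: H => //; first by rewrite mulnC.
    by rewrite coprime_sym.
  (* Coprimality leaves M = e = 1, and 2 = N^2 + 3 is impossible. *)
  move: cop; rewrite eMe /coprime gcdnn => /eqP ->; rewrite !exp1n => h.
  by move: h; clear; lia.
move=> hn cop M0 e0 heq.
have [r [s [rs hMe hsum]]] := quartic_pythagorean cop lt heq.
have sub (m k : nat) : coprime m k -> (0 < m * k)%N -> (m * k < M * e)%N ->
    forall N', (m ^ 4 + k ^ 4)%N <> (N' ^ 2 + 3 * (m * k) ^ 2)%N.
  move=> c; rewrite muln_gt0 => /andP[m0 k0] l N'; apply: IH => //.
  exact: leq_trans l _.
have [oM|oM] := boolP (odd M); last first.
  have hM : (M = 2 * (M %/ 2))%N by lia.
  have oe : odd e.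
    apply: contraT => oe; have : (2 %| gcdn M e)%N by rewrite dvdn_gcd !dvdn2 oM.
    by rewrite (eqP cop).
  have hm : ((M %/ 2) * e = r * s)%N by move: hMe; rewrite {1}hM; lia.
  have cop2 : coprime (M %/ 2) e.
    by apply: coprime_dvdl cop; rewrite {2}hM dvdn_mull.
  have [k [l [u [v [e1 e2 e3 e4]]]]] := four_numbers cop2 rs hm.
  have [ou ov] : odd u /\ odd v by move: oe; rewrite e2 oddM => /andP.
  (* For M even, u and v are odd, so modulo 4 this reads 0 = 1 + k^2 + l^2, which no parities
     satisfy. *)
  have : (4 * (k * l) ^ 2 = (u * v) ^ 2 + (k * u) ^ 2 + (l * v) ^ 2)%N.
    by rewrite -e3 -e4 -e2 -hsum hM e1; clear; lia.
  move=> /(congr1 (modn^~ 4)); rewrite modnMr -modnDm -(modnDm (_ ^ 2)) !sqr_mod4.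
  by rewrite !oddM ou ov !andbT; case: (odd k); case: (odd l).
have he : (e = 2 * (e %/ 2))%N.
  have : ~~ odd (M * e) by rewrite hMe oddM.
  rewrite oddM oM /= => h; lia.
have hm : (M * (e %/ 2) = r * s)%N by move: hMe; rewrite {1}he; lia.
have cop2 : coprime M (e %/ 2).
  by apply: coprime_dvdr cop; rewrite {2}he dvdn_mull.
have [k [l [u [v [e1 e2 e3 e4]]]]] := four_numbers cop2 rs hm.
have [kv lu] : coprime k v /\ coprime l u.
  move: cop2; rewrite e1 e2 !(coprimeMl, coprimeMr).
  by move=> /andP[/andP[_ ->] /andP[-> _]].
have [ok ol] : odd k /\ odd l by move: oM; rewrite e1 oddM => /andP.
have [u0 v0] : (0 < u)%N /\ (0 < v)%N by move: e0; rewrite he e2 !muln_gt0 => /andP[_ /andP[]].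
have hq : (k ^ 2 * l ^ 2 = k ^ 2 * u ^ 2 + v ^ 2 * (l ^ 2 + 4 * u ^ 2))%N.
  by rewrite -expnMn -e1 hsum e3 e4 he e2; clear; lia.
have small (w z : nat) : (0 < z)%N -> (M * e = 2 * (w * z))%N -> (0 < w)%N -> (w < M * e)%N.
  by clear; nia.
have k0 : (0 < k)%N by exact: odd_gt0.
have l0 : (0 < l)%N by exact: odd_gt0.
have ul : (u ^ 2 <= l ^ 2)%N.
  by rewrite -(@leq_pmul2l (k ^ 2)) ?expn_gt0 ?k0 // hq leq_addr.
have [d ld] : exists d, (l ^ 2 = u ^ 2 + d)%N by exists (l ^ 2 - u ^ 2)%N; rewrite subnKC.
have kd : (k ^ 2 * d = v ^ 2 * (l ^ 2 + 4 * u ^ 2))%N.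
  by apply/eqP; rewrite -(eqn_add2l (k ^ 2 * u ^ 2)) -hq ld mulnDr.
(* Since k and v are coprime, l^2 - u^2 = g v^2 and l^2 + 4u^2 = g k^2 for a common g. *)
have /dvdnP[g dg] : (v ^ 2 %| d)%N.
  rewrite -(@Gauss_dvdr _ (k ^ 2)); first by rewrite kd dvdn_mulr.
  by rewrite coprime_pexpl // coprime_pexpr // coprime_sym.
have gk : (l ^ 2 + 4 * u ^ 2 = g * k ^ 2)%N.
  apply/eqP; rewrite -(@eqn_pmul2l (v ^ 2)) ?expn_gt0 ?v0 // -kd dg.
  by apply/eqP; clear; lia.
have gl5 : (5 * l ^ 2 = g * (k ^ 2 + 4 * v ^ 2))%N.
  by move: gk; rewrite mulnDr => <-; rewrite ld dg; clear; lia.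
have gu5 : (5 * u ^ 2 + g * v ^ 2 = g * k ^ 2)%N.
  by rewrite -gk ld dg; clear; lia.
(* g divides both 5 l^2 and 5 u^2, and l, u are coprime. *)
have g5 : (g %| 5)%N.
  have gl : (g %| 5 * l ^ 2)%N by rewrite gl5 dvdn_mulr.
  have gu : (g %| 5 * u ^ 2)%N by rewrite -(dvdn_addl _ (dvdn_mulr (v ^ 2) (dvdnn g))) gu5 dvdn_mulr.
  have : (g %| gcdn (5 * l ^ 2) (5 * u ^ 2))%N by rewrite dvdn_gcd gl.
  by rewrite -muln_gcdr gcdn_sqr (eqP lu) muln1.
(* The two cases are exchanged by (l, u) <-> (k, v). *)
have /orP[/eqP g1|/eqP gE] : (g == 1%N) || (g == 5) by exact: (primeP (isT : prime 5)).2 g5.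
  have lsum : (l ^ 2 = u ^ 2 + v ^ 2)%N by rewrite ld dg g1 mul1n.
  have ksum : (k ^ 2 = l ^ 2 + 4 * u ^ 2)%N by rewrite gk g1 mul1n.
  have [m [n' [c mn h]]] := square_pair lu ol u0 lsum ksum.
  apply: (sub m n' c _ _ v) h; rewrite mn //.
  apply: (small _ (k * l * v)%N) => //; first by rewrite !muln_gt0 k0 l0.
  by rewrite {1}e1 he e2; clear; lia.
have ksum : (k ^ 2 = v ^ 2 + u ^ 2)%N by move: gu5; rewrite gE; clear; lia.
have lsum : (l ^ 2 = k ^ 2 + 4 * v ^ 2)%N by move: gl5; rewrite gE; clear; lia.
have [m [n' [c mn h]]] := square_pair kv ok v0 ksum lsum.
apply: (sub m n' c _ _ u) h; rewrite mn //.
apply: (small _ (k * l * u)%N) => //; first by rewrite !muln_gt0 k0 l0.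
by rewrite {1}e1 he e2; clear; lia.
Qed.

(** Modulo a and modulo d, w is a square of the other variable, so a, d, w are pairwise coprime. If
    their product is a square, each of them is, and the quartic equation acquires a solution. *)
Lemma quadratic_form_not_square (a d w t : nat) :
    coprime a d -> (0 < a)%N -> (0 < d)%N ->
    (a ^ 2 + d ^ 2 = w + 3 * (a * d))%N -> (a * d * w)%N <> (t ^ 2)%N.
Proof.
move=> ad a0 d0 hw ht.
have aw : coprime a w.
  rewrite /coprime -(gcdnMDl (3 * d)).
  have -> : (3 * d * a + w = a * a + d ^ 2)%N by move: hw; clear; lia.
  by rewrite gcdnMDl -/(coprime _ _) coprime_pexpr.
have dw : coprime d w.
  rewrite /coprime -(gcdnMDl (3 * a)).
  have -> : (3 * a * d + w = d * d + a ^ 2)%N by move: hw; clear; lia.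
  by rewrite gcdnMDl -/(coprime _ _) coprime_pexpr // coprime_sym.
have ea : a = (gcdn a t ^ 2)%N.
  by apply: (@coprime_mul_square _ (d * w)); rewrite ?coprimeMr ?ad // mulnA.
have ed : d = (gcdn d t ^ 2)%N.
  apply: (@coprime_mul_square _ (a * w)); first by rewrite coprimeMr coprime_sym ad.
  by rewrite -ht; clear; lia.
have ew : w = (gcdn w t ^ 2)%N.
  apply: (@coprime_mul_square _ (a * d)); last by rewrite -ht mulnC.
  by rewrite coprimeMr !(coprime_sym w) aw.
move: ea ed ew ad a0 d0 hw.
set M := gcdn a t; set e := gcdn d t; set N := gcdn w t => -> -> ->.
rewrite coprime_pexpl // coprime_pexpr // !expn_gt0 /= !orbF => cop M0 e0 h.
by apply: (@quartic_no_solution M e N cop M0 e0); rewrite expnMn -h -!expnM.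
Qed.

(** Put X = x + 1, so that y^2 = X (X^2 - 3X + 1). A nonzero X is positive, and X = U/D in lowest
    terms makes U D (U^2 - 3UD + D^2) a square, contradicting the descent. *)
Lemma curve_m2_m1_points (x y : rat) :
  y ^+ 2 = x ^+ 3 - 2 * x - 1 -> x = -1.
Proof.
move=> hxy; apply/eqP; rewrite -subr_eq0 opprK; apply: contraT => X0.
set X := x + 1 in X0.
have {}hxy : y ^+ 2 = X * (X ^+ 2 - 3 * X + 1) by rewrite hxy /X; ring.
have {}X0 : 0 < X.
  rewrite lt_neqAle eq_sym X0 /= leNgt; apply/negP => Xn.
  by have := sqr_ge0 y; rewrite hxy; nra.
have U0 : 0 < numq X by rewrite numq_gt0.
set U := numq X in U0; set D := denq X; set B := numq y; set E := denq y.
have D0 : 0 < D by exact: denq_gt0.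
pose W := U ^+ 2 - 3 * U * D + D ^+ 2.
have hi : (B * D ^+ 2) ^+ 2 = E ^+ 2 * (U * D * W).
  apply: (@intr_inj rat); rewrite /W !(rmorph_nat, rmorphM, rmorphD, rmorphN, rmorphXn) /=.
  have hD : D%:~R != 0 :> rat by rewrite intr_eq0 denq_eq0.
  have hE : E%:~R != 0 :> rat by rewrite intr_eq0 denq_eq0.
  have -> : B%:~R = y * E%:~R by rewrite -{1}(divq_num_den y) divfK.
  have -> : U%:~R = X * D%:~R by rewrite -{1}(divq_num_den X) divfK.
  transitivity (E%:~R ^+ 2 * D%:~R ^+ 4 * y ^+ 2); [by ring|by rewrite hxy; ring].
(* E^2 divides (B D^2)^2, hence U D W is the square of the integer T = B D^2 / E. *)
have /dvdzP[T hT] : (E %| B * D ^+ 2)%Z.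
  by rewrite dvdzE -(@dvdn_pexp2r _ _ 2) // -!abszX hi abszM dvdn_mulr.
have E0 : E != 0 by exact: denq_neq0.
have hT2 : U * D * W = T ^+ 2.
  by apply: (mulfI (expf_neq0 2 E0)); rewrite -hi hT exprMn mulrC.
have W0 : 0 <= W by have := sqr_ge0 T; rewrite -hT2 pmulr_rge0 // mulr_gt0.
have := @quadratic_form_not_square `|U| `|D| `|W| `|T| (coprime_num_den X).
case; rewrite ?absz_gt0 ?gt_eqF //.
  by apply/eqP; rewrite -eqz_nat; move: U0 D0 W0; rewrite /W; clear; lia.
by move: (congr1 absz hT2); rewrite abszX !abszM.
Qed.

(** * Reduction modulo p *)

Lemma intr_Fp_eq0 (p : nat) (m : int) :
  prime p -> (m%:~R == 0 :> 'F_p) = (p%:Z %| m)%Z.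
Proof. by move=> pr; rewrite -(dvdz_pcharf (pchar_Fp pr)). Qed.

Fact padic_reduction_zmod_morphism (v : finite_place) :
  zmod_morphism (@padic_reduction v).
Proof.
move=> x y; have pr : prime (val v) := valP v.
rewrite /padic_reduction; apply/eqP; rewrite -rmorphB /= -subr_eq0 -rmorphB /=.
rewrite intr_Fp_eq0 //.
have -> : val v = (val v ^ 1)%N by rewrite expn1.
by rewrite /= /padic_trunc /= modzDmr -eqz_mod_dvd modz_mod.
Qed.

Fact padic_reduction_monoid_morphism (v : finite_place) :
  monoid_morphism (@padic_reduction v).
Proof.
have pr : prime (val v) := valP v.
split=> [|x y]; rewrite /padic_reduction; apply/eqP.
  rewrite /= /padic_trunc -subr_eq0 -(rmorph1 (intr : int -> 'F_(val v))) -rmorphB /=.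
  rewrite intr_Fp_eq0 //.
  have -> : val v = (val v ^ 1)%N by rewrite expn1.
  by rewrite -eqz_mod_dvd modz_mod.
rewrite -rmorphM /= -subr_eq0 -rmorphB /= intr_Fp_eq0 //.
have -> : val v = (val v ^ 1)%N by rewrite expn1.
by rewrite /= /padic_trunc -eqz_mod_dvd modz_mod.
Qed.

HB.instance Definition _ (v : finite_place) :=
  GRing.isZmodMorphism.Build _ _ (@padic_reduction v)
    (@padic_reduction_zmod_morphism v).
HB.instance Definition _ (v : finite_place) :=
  GRing.isMonoidMorphism.Build _ _ (@padic_reduction v)
    (@padic_reduction_monoid_morphism v).

(** E_0 contains the identity, so P lies in its own coset P + E_0; as there is only one coset, this
    is 0 + E_0 = E_0. *)
Lemma tamagawa1_E0 (v : finite_place) (a4 a6 : int) :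
  tamagawa_number v a4 a6 = 1%N -> forall P : ecpoint (padic v) a4 a6, E0 P.
Proof.
move=> /eqP/cardfs1P[S hS] P.
(* [fset_set] is empty on an infinite set, so cardinality 1 already implies finiteness. *)
have fin : finite_set (range (@E0_coset v a4 a6)).
  apply: contrapT => hinf; move: hS; rewrite /fset_set; case: pselect => // _.
  by move=> /(congr1 (fun A => S \in A)); rewrite !inE eqxx.
have coset Q : E0_coset Q = S.
  have : E0_coset Q \in fset_set (range (@E0_coset v a4 a6)).
    by rewrite in_fset_set // inE; exists Q.
  by rewrite hS inE => /eqP.
have E00 : E0 (ec_zero (padic v) a4 a6).
  exists 0, 1, 0; rewrite /padic_to_frac !rmorph0 !rmorph1; split.
  - by split=> //; exact: oner_neq0.
  - by case=> _ /eqP; rewrite oner_eq0.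
  - case=> _ _ /eqP; rewrite !(expr0n, expr1n, mulr0) !subr0.
    by rewrite oner_eq0.
have : E0_coset P P by exists (ec_zero (padic v) a4 a6) => //; exact: ec_addr0.
by rewrite coset -(coset (ec_zero _ _ _)) => -[Q hQ]; rewrite ec_add0 => <-.
Qed.

(* x(2P) = dup_num / dup_den when x(P) = A / D. *)
Definition dup_num (a4 a6 A D : int) : int :=
  A ^+ 4 - 2 * a4 * A ^+ 2 * D ^+ 2 - 8 * a6 * A * D ^+ 3 + a4 ^+ 2 * D ^+ 4.

Definition dup_den (a4 a6 A D : int) : int :=
  4 * D * (A ^+ 3 + a4 * A * D ^+ 2 + a6 * D ^+ 3).

(** The curve equation with denominators cleared lives over the integers, so one rational point can
    be read both in Q_p and in F_p. *)
Lemma on_curve_intr (F : fieldType) (a4 a6 A D B E : int) :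
    D%:~R != 0 :> F -> E%:~R != 0 :> F ->
    B ^+ 2 * D ^+ 3 = E ^+ 2 * (A ^+ 3 + a4 * A * D ^+ 2 + a6 * D ^+ 3) ->
  on_curve a4 a6 (Some (A%:~R / D%:~R : F, B%:~R / E%:~R : F)).
Proof.
move=> hD hE /(congr1 (intr : int -> F)).
rewrite !(rmorphM, rmorphD, rmorphXn) /= => hc.
apply/eqP; have h : E%:~R ^+ 2 * D%:~R ^+ 3 != 0 :> F by rewrite mulf_neq0 ?expf_neq0.
apply: (mulfI h); transitivity (B%:~R ^+ 2 * D%:~R ^+ 3 : F); first by field.
by rewrite hc; field.
Qed.

(** Up to the factor D^4, [dup_den] is 4f = (2y)^2 and [dup_num] is (3x^2 + a4)^2 - 8xf, where f =
    x^3 + a4 x + a6 = y^2. If both vanish, so do the two partial derivatives. *)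
Lemma singular_reduction (F : fieldType) (a4 a6 A D B E : int) :
    D%:~R != 0 :> F -> E%:~R != 0 :> F ->
    B ^+ 2 * D ^+ 3 = E ^+ 2 * (A ^+ 3 + a4 * A * D ^+ 2 + a6 * D ^+ 3) ->
    (dup_num a4 a6 A D)%:~R = 0 :> F -> (dup_den a4 a6 A D)%:~R = 0 :> F ->
  let x := A%:~R / D%:~R : F in let y := B%:~R / E%:~R : F in
  [/\ on_curve a4 a6 (Some (x, y)), 2%:R * y = 0 & 3%:R * x ^+ 2 + a4%:~R = 0].
Proof.
move=> D0 E0 hc hn hd x y; have /eqP oc := on_curve_intr D0 E0 hc.
rewrite -/x -/y in oc.
have xE : A%:~R = x * D%:~R :> F by rewrite /x divfK.
move: hn hd; rewrite /dup_num /dup_den.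
rewrite !(rmorph_nat, rmorphM, rmorphD, rmorphN, rmorphXn) /= xE.
set d : F := D%:~R in D0 *; set a : F := a4%:~R; set b : F := a6%:~R => hn hd.
rewrite -/a -/b in oc.
have y0 : 2%:R * y = 0.
  apply/eqP; rewrite -sqrf_eq0; apply/eqP.
  have h : d ^+ 4 != 0 by rewrite expf_neq0.
  apply: (mulfI h); rewrite mulr0 -[RHS]hd.
  by transitivity (4 * d ^+ 4 * y ^+ 2); [ring|rewrite oc; ring].
split=> //; first by apply/eqP.
apply/eqP; rewrite -sqrf_eq0; apply/eqP.
have h : d ^+ 4 != 0 by rewrite expf_neq0.
apply: (mulfI h); rewrite mulr0.
transitivity (2%:R * d ^+ 4 * x * (2%:R * y) ^+ 2); last by rewrite y0; ring.
rewrite -[LHS]subr0 -hn.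
transitivity (8%:R * d ^+ 4 * x * (x ^+ 3 + a * x + b)); last by rewrite -oc; ring.
by ring.
Qed.

Lemma padic_intr_neq0 (v : finite_place) (m : int) :
  m%:~R != 0 :> 'F_(val v) -> m%:~R != 0 :> padic v.
Proof.
apply: contraNneq => h; have {}h : padic_to_frac (m%:~R : padic_int v) = 0.
  by rewrite /padic_to_frac rmorph_int.
move/eqP: h; rewrite /padic_to_frac tofrac_eq0 => /eqP h.
by rewrite -(rmorph_int (@padic_reduction v)) h rmorph0.
Qed.

(** The relation D X = A Z holds in Z_p itself and survives reduction, where D is invertible. *)
Lemma padic_reduction_frac (v : finite_place) (A D : int) (X Z : padic_int v) :
    D%:~R != 0 :> 'F_(val v) ->
    padic_to_frac X = A%:~R / D%:~R * padic_to_frac Z ->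
  padic_reduction X = A%:~R / D%:~R * padic_reduction Z.
Proof.
move=> D0; have hD := padic_intr_neq0 D0; rewrite /padic_to_frac => hX.
have /eqP : FracField.tofrac (X * D%:~R) = FracField.tofrac (A%:~R * Z).
  rewrite [LHS]tofracM [RHS]tofracM hX.
  have e (m : int) : FracField.tofrac (m%:~R : padic_int v) = m%:~R by exact: rmorph_int.
  by rewrite !e mulrAC divfK.
rewrite tofrac_eq => /eqP/(congr1 (@padic_reduction v)).
rewrite !rmorphM !rmorph_int => h.
by apply: (mulIf D0); rewrite h mulrAC divfK.
Qed.

(** Every integral triple for P reduces to z (x, y, 1), and the partial derivatives are homogeneous
    of degree 2, so they all vanish at the triple supplied by [E0]. *)
Lemma E0_not_singular (v : finite_place) (a4 a6 A D B E : int) :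
    D%:~R != 0 :> 'F_(val v) -> E%:~R != 0 :> 'F_(val v) ->
    B ^+ 2 * D ^+ 3 = E ^+ 2 * (A ^+ 3 + a4 * A * D ^+ 2 + a6 * D ^+ 3) ->
    (forall P : ecpoint (padic v) a4 a6, E0 P) ->
  let x := A%:~R / D%:~R : 'F_(val v) in let y := B%:~R / E%:~R : 'F_(val v) in
  ~ [/\ on_curve a4 a6 (Some (x, y)), 2%:R * y = 0 & 3%:R * x ^+ 2 + a4%:~R = 0].
Proof.
move=> D0 E0' hc hP x y [/eqP oc hy hx].
have nz := @padic_intr_neq0 v.
have hD := nz _ D0; have hE := nz _ E0'.
have oQ := on_curve_intr hD hE hc.
have [X [Y [Z [[hZ hX hY] hred hns]]]] := hP (ECPoint oQ).
have toX := padic_reduction_frac D0 hX; have toY := padic_reduction_frac E0' hY.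
rewrite -/x in toX; rewrite -/y in toY.
apply: hns; rewrite toX toY; set z := padic_reduction Z; split.
- by transitivity (z ^+ 2 * (3%:R * x ^+ 2 + a4%:~R)); [ring|rewrite hx mulr0].
- by transitivity (z ^+ 2 * (2%:R * y)); [ring|rewrite hy mulr0].
(* On the curve the third partial derivative is a combination of the other two. *)
- have -> : a6%:~R = y ^+ 2 - x ^+ 3 - a4%:~R * x :> 'F_(val v) by rewrite oc; ring.
  transitivity (z ^+ 2 * (x * (3%:R * x ^+ 2 + a4%:~R) - y * (2%:R * y))); first by ring.
  by rewrite hx hy; ring.
Qed.

(* A prime dividing both would make P reduce to a singular point. *)
Lemma coprime_duplication (a4 a6 : int) (x y : rat) :
    (forall v : finite_place,
      bad_reduction v a4 a6 -> tamagawa_number v a4 a6 = 1%N) ->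
    on_curve a4 a6 (Some (x, y)) ->
  coprimez (dup_num a4 a6 (numq x) (denq x)) (dup_den a4 a6 (numq x) (denq x)).
Proof.
move=> htam /eqP oc; set A := numq x; set D := denq x.
pose B := numq y; pose E := denq y.
have hc : B ^+ 2 * D ^+ 3 = E ^+ 2 * (A ^+ 3 + a4 * A * D ^+ 2 + a6 * D ^+ 3).
  apply: (@intr_inj rat); rewrite !(rmorphM, rmorphD, rmorphXn) /=.
  have hD : D%:~R != 0 :> rat by rewrite intr_eq0 denq_eq0.
  have hE : E%:~R != 0 :> rat by rewrite intr_eq0 denq_eq0.
  have -> : B%:~R = y * E%:~R by rewrite -{1}(divq_num_den y) divfK.
  have -> : A%:~R = x * D%:~R by rewrite -{1}(divq_num_den x) divfK.
  by rewrite exprMn oc; ring.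
apply: contrapT => /negP; rewrite /coprimez /gcdz => hg.
set g := gcdn _ _ in hg.
have [p pr pg] : exists2 p, prime p & (p %| g)%N.
  (* When g = 0 every prime divides it. *)
  have [->|g0] := eqVneq g 0%N; first by exists 2%N.
  exists (pdiv g); last exact: pdiv_dvd.
  by apply: pdiv_prime; rewrite ltn_neqAle eq_sym lt0n g0 andbT.
have [pn pd] : (p %| dup_num a4 a6 A D)%Z /\ (p %| dup_den a4 a6 A D)%Z.
  by split; rewrite dvdzE /= (dvdn_trans pg) // ?dvdn_gcdl ?dvdn_gcdr.
have copAD : coprime `|A| `|D| by rewrite coprime_num_den.
have copBE : coprime `|B| `|E| by rewrite coprime_num_den.
have nop (m n : int) : coprime `|m| `|n| -> (p %| m)%Z -> (p %| n)%Z -> False.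
  rewrite !dvdzE /= => h h1 h2; have : (p %| gcdn `|m| `|n|)%N by rewrite dvdn_gcd h1.
  by rewrite (eqP h) dvdn1 => /eqP p1; rewrite p1 in pr.
have pX (m : int) k : (p %| m ^+ k)%Z -> (p %| m)%Z.
  by rewrite !dvdzE /= abszX Euclid_dvdX // => /andP[].
have pD : ~~ (p %| D)%Z.
  apply/negP => pD; apply: (nop _ _ copAD) => //; apply: (pX _ 4%N).
  have -> : A ^+ 4 = dup_num a4 a6 A D +
    D * (2 * a4 * A ^+ 2 * D + 8 * a6 * A * D ^+ 2 - a4 ^+ 2 * D ^+ 3).
    by rewrite /dup_num; ring.
  by rewrite rpredD // dvdz_mulr.
have pE : ~~ (p %| E)%Z.
  apply/negP => pE; have : (p %| B ^+ 2 * D ^+ 3)%Z by rewrite hc expr2 -!mulrA dvdz_mulr.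
  rewrite dvdzE /= abszM Euclid_dvdM // => /orP[h|h].
    by apply: (nop _ _ copBE) => //; exact: (pX _ 2%N).
  by move/negP: pD; apply; exact: (pX _ 3%N).
pose v : finite_place := exist _ p pr.
rewrite -!(intr_Fp_eq0 _ pr) in pn pd pD pE.
have /= sing := singular_reduction pD pE hc (eqP pn) (eqP pd).
apply: (@E0_not_singular v _ _ _ _ _ _ pD pE hc _ sing).
(* A singular point modulo p forces p to divide the discriminant, so c_p = 1 is available. *)
apply/tamagawa1_E0/htam; rewrite /bad_reduction; apply/eqP; apply: contrapT => /negP hd.
have [oc' hy hx] := sing.
by have := nonsingular_point hd oc' hy; rewrite hx eqxx.
Qed.

(** * The real inequality *)

Lemma small_step (p q c d : rat) : 0 < p -> 0 < q -> 0 < c -> 0 < d ->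
  exists e : rat, [/\ 0 < e, e <= 1, e * c < p & e * d < q].
Proof.
move=> p0 q0 c0 d0; exists (Num.min 1 (Num.min (p / (2 * c)) (q / (2 * d)))).
have [pc qd] : 0 < p / (2 * c) /\ 0 < q / (2 * d) by rewrite !divr_gt0 // mulr_gt0.
split; first by rewrite !lt_min ltr01 pc qd.
- by rewrite ge_min lexx.
- apply: (@le_lt_trans _ _ (p / (2 * c) * c)).
    by rewrite ler_pM2r // !ge_min lexx !orbT.
  by rewrite invfM mulrA divfK ?gt_eqF // ltr_pdivrMr //; lra.
- apply: (@le_lt_trans _ _ (q / (2 * d) * d)).
    by rewrite ler_pM2r // !ge_min lexx !orbT.
  by rewrite invfM mulrA divfK ?gt_eqF // ltr_pdivrMr //; lra.
Qed.

(* A zero of the cubic is simple, hence adherent to the region where it is positive. *)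
Lemma dup_quad_le0 (a b x : rat) :
    (forall z, 0 < z ^+ 3 + a * z + b -> 2 * a * z ^+ 2 + 8 * b * z - a ^+ 2 < 0) ->
    4 * a ^+ 3 + 27 * b ^+ 2 != 0 -> 0 <= x ^+ 3 + a * x + b ->
  2 * a * x ^+ 2 + 8 * b * x - a ^+ 2 <= 0.
Proof.
move=> H hd; rewrite le_eqVlt => /orP[/eqP fx|/H/ltW//].
rewrite leNgt; apply/negP => Dx; set D := _ - a ^+ 2 in Dx.
pose d := 3 * x ^+ 2 + a.
have d0 : d != 0.
  apply: contraNneq hd => hd0.
  have ea : a = - (3 * x ^+ 2) by apply/eqP; rewrite -addr_eq0 addrC -/d hd0.
  have eb : b = - x ^+ 3 - a * x by rewrite -[LHS]subr0 fx; ring.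
  by rewrite eb ea; apply/eqP; ring.
(* Move from x by e in the direction of the sign of d = f'(x). The first bound on e lets the linear
   term dominate, making f positive; the second keeps the quadratic positive, which contradicts
   [H]. *)
have [e [e0 e1 ec ed]] := @small_step `|d| D (3 * `|x| + 1)
  (`|4 * a * x + 8 * b| + `|2 * a| + 1) ltac:(by rewrite normr_gt0) Dx
  ltac:(by rewrite ltr_wpDl // mulr_ge0) ltac:(by rewrite ltr_wpDl // addr_ge0).
have [h hE hn] : exists2 h, h = Num.sg d * e & `|h| = e.
  by exists (Num.sg d * e) => //; rewrite normrM normr_sg d0 mul1r gtr0_norm.
have hh : h ^+ 2 = e ^+ 2 by rewrite -[LHS]real_normK ?num_real // hn.
have f_pos : 0 < (x + h) ^+ 3 + a * (x + h) + b.
  have -> : (x + h) ^+ 3 + a * (x + h) + b =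
      (x ^+ 3 + a * x + b) + e * (Num.sg d * d) + e ^+ 2 * (3 * x + h).
    by rewrite -hh /d hE; ring.
  rewrite -fx add0r -normrEsg.
  have h1 : - (e * (3 * `|x| + 1)) <= e * (3 * x + h).
    rewrite -mulrN ler_pM2l //.
    have := ler_norm (- x); have := ler_norm (- h); rewrite !normrN hn.
    by move: e1; clear; lra.
  rewrite expr2 -mulrA -mulrDr mulr_gt0 //.
  by move: h1 ec; clear; lra.
have := H _ f_pos.
have -> : 2 * a * (x + h) ^+ 2 + 8 * b * (x + h) - a ^+ 2 =
   D + h * (4 * a * x + 8 * b) + e ^+ 2 * (2 * a).
  by rewrite -hh /D; clear; ring.
have n1 := ler_norm (- (h * (4 * a * x + 8 * b))).
rewrite normrN normrM hn in n1.
have n2 := ler_norm (- (2 * a)); rewrite normrN in n2.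
have n3 : e ^+ 2 * `|2 * a| <= e * `|2 * a|.
  by rewrite ler_wpM2r // expr2 ler_piMr // ltW.
have n4 : e ^+ 2 * - (2 * a) <= e ^+ 2 * `|2 * a| by rewrite ler_wpM2l // sqr_ge0.
move: e0 Dx ed n1 n4 n3; clearbody D; move: (4 * a * x + 8 * b) (2 * a) => u w.
by clear; lra.
Qed.

(* The bound x^3 >= 3x/4 - 1/4 is (x - 1/2)^2 (x + 1) >= 0. *)
Lemma cubic_case_bounds (m b : nat) (x : rat) : 0 < x < 1 -> (0 < b)%N ->
  0 <= x ^+ 3 - m%:R * x + b%:R -> x ^+ 3 - m%:R * x + b%:R < 1 / 4 ->
  (m < 5)%N -> (m, b) \in [:: (2, 1); (3, 1); (3, 2); (4, 1); (4, 2); (4, 3)]%N.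
Proof.
move=> /andP[x0 x1] b0 f0 f1 m5.
have c3 : 3 / 4 * x - 1 / 4 <= x ^+ 3.
  have : 0 <= (x - 1 / 2) ^+ 2 * (x + 1) by rewrite mulr_ge0 ?sqr_ge0 //; lra.
  by set t := x in x0 x1 *; clear; lra.
have mb : (b <= m)%N.
  rewrite leqNgt; apply/negP => lt.
  have : m%:R + 1 <= b%:R :> rat by rewrite natr1 ler_nat.
  have : m%:R * x <= m%:R by rewrite ler_piMr // ltW.
  by move: x0 x1 f1 c3; clear; lra.
by move: m b m5 mb b0 f0 f1 => [|[|[|[|[|m]]]]] [|[|[|[|[|b]]]]] // *; lra.
Qed.

(** The quartic equals (m - 3x^2)^2 - 8xf with f = x^3 - mx - c, a sum of nonnegative terms for x <
    0. Its first term is at least 1 for m >= 4. Otherwise c < m leaves (2, 1), (3, 1) and (3, 2),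
    the last of discriminant zero. *)
Lemma dup_bound_neg (m c : nat) (x : rat) : -1 < x < 0 ->
    0 <= x ^+ 3 - m%:R * x - c%:R -> (0 < c)%N -> (m, c) <> (2, 1)%N ->
    4 * (- m%:R) ^+ 3 + 27 * (- c%:R) ^+ 2 != 0 :> rat ->
  1 <= x ^+ 4 + 2 * m%:R * x ^+ 2 + 8 * c%:R * x + m%:R ^+ 2.
Proof.
move=> /andP[x1 x0] f0 c0 hmc hd.
have cm : (c < m)%N.
  rewrite ltnNge; apply/negP => h; have : m%:R <= c%:R :> rat by rewrite ler_nat.
  have h1 : m%:R * - x <= m%:R by rewrite ler_piMr //; move: x1; clear; lra.
  have h2 : x ^+ 3 < 0 by rewrite exprn_odd_lt0.
  by move: f0 h1 h2; clear; lra.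
have -> : x ^+ 4 + 2 * m%:R * x ^+ 2 + 8 * c%:R * x + m%:R ^+ 2 =
    (m%:R - 3 * x ^+ 2) ^+ 2 + - (8 * x) * (x ^+ 3 - m%:R * x - c%:R) by ring.
have h0 : 0 <= - (8 * x) * (x ^+ 3 - m%:R * x - c%:R).
  by apply: mulr_ge0 f0; move: x0; clear; lra.
have xx : x ^+ 2 <= 1 by rewrite -[x ^+ 2]sqrrN expr_le1 //; move: x0 x1; clear; lra.
have [m4|m4] := leqP 4 m.
  have : 4 <= m%:R :> rat by rewrite (ler_nat _ 4).
  move=> h; have : 1 <= (m%:R - 3 * x ^+ 2) ^+ 2.
    by rewrite exprn_ege1 //; move: h xx; clear; lra.
  by move: h0; clear; lra.
have : (m, c) \in [:: (2, 1); (3, 1); (3, 2)]%N.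
  by move: m4 cm c0; clear; move: m c => [|[|[|[|m]]]] [|[|[|c]]].
rewrite !inE => /or3P[] /eqP[em ec]; move: hmc hd; rewrite {}em {}ec => hmc hd.
- by case: hmc.
- by move: (sqr_ge0 (x + 2 / 3)) (sqr_ge0 (x ^+ 2)); clear; lra.
- by case/negP: hd; apply/eqP; clear; ring.
Qed.

(** For m >= 5, (m - 3x^2)^2 - 8xf is at least 4 - 2, since f < 1/4. For smaller m the finite list
    of [cubic_case_bounds] is checked pair by pair. *)
Lemma dup_bound_pos (m b : nat) (x : rat) :
    (forall z : rat, 0 < z ^+ 3 - m%:R * z + b%:R ->
       - 2 * m%:R * z ^+ 2 + 8 * b%:R * z - m%:R ^+ 2 < 0) ->
    0 < x < 1 ->
    0 <= x ^+ 3 - m%:R * x + b%:R < 1 / 4 -> (0 < b)%N -> (m, b) <> (2, 1)%N ->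
    4 * (- m%:R) ^+ 3 + 27 * b%:R ^+ 2 != 0 :> rat ->
  1 <= x ^+ 4 + 2 * m%:R * x ^+ 2 - 8 * b%:R * x + m%:R ^+ 2.
Proof.
move=> H x01 /andP[f0 f1] b0 hmb hd.
have [m5|m5] := leqP 5 m.
  have -> : x ^+ 4 + 2 * m%:R * x ^+ 2 - 8 * b%:R * x + m%:R ^+ 2 =
    (m%:R - 3 * x ^+ 2) ^+ 2 - 8 * x * (x ^+ 3 - m%:R * x + b%:R) by ring.
  move/andP: x01 => [x0 x1].
  have xx : x ^+ 2 <= 1 by rewrite expr_le1 // ltW.
  have m5' : 5 <= m%:R :> rat by rewrite (ler_nat _ 5).
  have h1 : 2 ^+ 2 <= (m%:R - 3 * x ^+ 2) ^+ 2.
    by rewrite lerXn2r ?nnegrE //; move: xx m5'; clear; lra.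
  have h2 : x * (x ^+ 3 - m%:R * x + b%:R) <= x ^+ 3 - m%:R * x + b%:R.
    by rewrite ler_piMl // ltW.
  by move: h1 h2 f1; clear; lra.
have := cubic_case_bounds x01 b0 f0 f1 m5.
move/andP: x01 => [x0 x1].
have q := (sqr_ge0 (x - 1), sqr_ge0 x, sqr_ge0 (x - 1 / 2), sqr_ge0 (x ^+ 2)).
move: q; rewrite !inE => -[[[q1 q2] q3] q4] hmem.
have {hmem} : [\/ m = 3 /\ b = 1, m = 3 /\ b = 2, m = 4 /\ b = 1 | m = 4 /\ b = 2]%N \/ (m = 4 /\ b = 3)%N.
  move: hmb hmem; clear => hmb.
  case/or4P => [/eqP //|/eqP[-> ->]|/eqP[-> ->]|/or3P[]/eqP[-> ->]].
  - by left; constructor 1.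
  - by left; constructor 2.
  - by left; constructor 3.
  - by left; constructor 4.
  - by right.
move=> [[]|] [em eb]; move: hd H; rewrite {}em {}eb => hd H.
- by move: x0 x1 q1 q2 q3 q4; clear; lra.
- by case/negP: hd; apply/eqP; clear; ring.
- by move: x0 x1 q1 q2 q3 q4; clear; lra.
- by move: x0 x1 q1 q2 q3 q4; clear; lra.
(* The pair (4, 3) violates [H] at z = 3/2, where the cubic is 3/8 and the quadratic is 2. *)
- have h : 0 < (3 / 2) ^+ 3 - 4%:R * (3 / 2) + 3%:R :> rat by clear; lra.
  by move: (H _ h); clear; lra.
Qed.

Lemma dup_bound (a4 a6 : int) (x : rat) :
    let a : rat := a4%:~R in let b : rat := a6%:~R in
    a4 <= 0 ->
    (forall z, 0 < z ^+ 3 + a * z + b -> 2 * a * z ^+ 2 + 8 * b * z - a ^+ 2 < 0) ->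
    4 * a ^+ 3 + 27 * b ^+ 2 != 0 ->
    (a4, a6) <> (-2, 1) -> (a4, a6) <> (-2, -1) ->
    0 <= x ^+ 3 + a * x + b ->
  let num := x ^+ 4 - 2 * a * x ^+ 2 - 8 * b * x + a ^+ 2 in
  x ^+ 4 <= num /\ (1 <= num \/ 1 <= 4 * (x ^+ 3 + a * x + b)).
Proof.
move=> a b a4le H hd n1 n2 f0 num.
have D0 := dup_quad_le0 H hd f0.
have x4 : x ^+ 4 <= num by move: D0; rewrite /num; clear; lra.
split=> //.
have [xge|xlt] := lerP 1 `|x|.
  left; apply: le_trans x4.
  by rewrite -(@ger0_norm _ (x ^+ 4)) ?exprn_even_ge0 // normrX exprn_ege1.
have [m em] : exists m : nat, a4 = - m%:Z by exists `|a4|%N; lia.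
have am : a = - m%:R by rewrite /a em rmorphN.
have [x1 x2] : -1 < x /\ x < 1 by apply/andP; rewrite -ltr_norml.
have sqx := sqr_ge0 x.
have [m0|m0] := posnP m.
  (* For a4 = 0, testing [H] at |b| + 1 gives b < 0, hence b <= -1; then f(x) >= 0 contradicts x <
     1. *)
  have {}am : a = 0 by rewrite am m0 oppr0.
  have bneg : b < 0.
    have := H (`|b| + 1); rewrite am => h.
    have b1 : `|b| + 1 <= (`|b| + 1) ^+ 3.
      have : 1 <= (`|b| + 1) ^+ 2 by rewrite exprn_ege1 // lerDr.
      by move=> /(ler_wpM2l (addr_ge0 (normr_ge0 b) ler01)); rewrite mulr1 -exprS.
    have b2 := ler_norm (- b); rewrite normrN in b2.
    have {}h : 8 * b * (`|b| + 1) < 0.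
      have {h} := h _; rewrite !mulr0 !mul0r expr0n addr0 subr0 add0r; apply.
      by move: b1 b2; clear; lra.
    by rewrite pmulr_llt0 ?ltr_wpDl // pmulr_rlt0 // in h.
  exfalso.
  have : a6 <= -1 by rewrite -[X in _ <= X]opprK; move: bneg; rewrite /b ltrz0; clear; lia.
  rewrite -(ler_int rat) -/b => b1.
  have : x ^+ 3 < 1.
    have [xn|xp] := lerP 0 x; first by rewrite exprn_ilt1.
    by apply: lt_trans ltr01; rewrite exprn_odd_lt0.
  by move: f0; rewrite am mul0r addr0; move: b1; rewrite rmorphN /=; clear; lra.
have numE : num = x ^+ 4 + 2 * m%:R * x ^+ 2 - 8 * b * x + m%:R ^+ 2.
  by rewrite /num am; ring.
have fE : x ^+ 3 + a * x + b = x ^+ 3 - m%:R * x + b by rewrite am; ring.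
rewrite {}numE {}fE in f0 *.
(* When b x <= 0 every term of the quartic is nonnegative and m^2 is at least 1. *)
have [bx|bx] := lerP (b * x) 0.
  left.
  have h1 : 1 <= m%:R ^+ 2 :> rat by rewrite exprn_ege1 // ler1n.
  have h2 : 0 <= x ^+ 4 by rewrite exprn_even_ge0.
  have h3 : 0 <= m%:R * x ^+ 2 by rewrite mulr_ge0.
  by move: h1 h2 h3 bx; clear; lra.
have [x0|x0|x0] := ltgtP x 0; last by move: bx; rewrite x0 mulr0 ltxx.
- left; rewrite nmulr_lgt0 // in bx.
  have [c [c0 ec]] : exists c : nat, (0 < c)%N /\ a6 = - c%:Z.
    by exists `|a6|%N; move: bx; rewrite /b ltrz0; clear; lia.
  have eb : b = - c%:R by rewrite /b ec rmorphN.
  rewrite eb mulrN !mulNr opprK; apply: dup_bound_neg => //.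
  + by rewrite x1.
  + by rewrite -eb.
  + by move=> [e1 e2]; apply: n2; rewrite em ec e1 e2.
  + by rewrite -am -eb.
rewrite pmulr_lgt0 // in bx.
have [c [c0 ec]] : exists c : nat, (0 < c)%N /\ a6 = c%:Z.
  by exists `|a6|%N; move: bx; rewrite /b ltr0z; clear; lia.
have eb : b = c%:R by rewrite /b ec.
have [f1|f1] := lerP 1 (4 * (x ^+ 3 - m%:R * x + b)); [by right|left].
rewrite eb in f0 f1 *; apply: dup_bound_pos => //.
- by move=> z; have := H z; rewrite am eb sqrrN !(mulNr, mulrN).
- by rewrite x0.
- by rewrite f0; move: f1; clear; lra.
- by move=> [e1 e2]; apply: n1; rewrite em ec e1 e2.
- by rewrite -am -eb.
Qed.

(** * Heights *)

(** Gauss's lemma: the product of the primitive polynomials C X - A and D X - B is primitive, so AB,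
    AD + BC and CD have gcd 1. *)
Lemma primitive_dvd (A B C D T : int) :
    coprimez A C -> coprimez B D ->
    (C * D %| T * (A * B))%Z -> (C * D %| T * (A * D + B * C))%Z ->
  (C * D %| T)%Z.
Proof.
move=> AC BD h1 h2.
suff g1 : gcdn `|A * B| (gcdn `|A * D + B * C| `|C * D|) = 1%N.
  rewrite dvdzE -[X in (_ %| X)%N]muln1 -g1 !muln_gcdr !dvdn_gcd -!abszM.
  by rewrite -!dvdzE h1 h2 dvdz_mull.
apply/eqP; rewrite -[_ == _]negbK; apply/negP => g1.
set g := gcdn _ _ in g1.
have [p pr pg] : exists2 p, prime p & (p %| g)%N.
  have [->|g0] := eqVneq g 0%N; first by exists 2%N.
  exists (pdiv g); last exact: pdiv_dvd.
  by apply: pdiv_prime; rewrite ltn_neqAle eq_sym g1 lt0n g0.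
have nop (m n : int) : coprimez m n -> (p %| m)%Z -> (p %| n)%Z -> False.
  rewrite /coprimez /gcdz !dvdzE /= => h hm hn.
  have : (p %| gcdn `|m| `|n|)%N by rewrite dvdn_gcd hm.
  by case/eqP: h => ->; rewrite dvdn1 => /eqP p1; rewrite p1 in pr.
have pM (m n : int) : (p %| m * n)%Z -> (p %| m)%Z \/ (p %| n)%Z.
  by rewrite !dvdzE abszM Euclid_dvdM // => /orP.
move: pg; rewrite /g !dvdn_gcd => /and3P[pAB ps pCD].
have {}pAB : (p %| A * B)%Z by []. have {}ps : (p %| A * D + B * C)%Z by [].
have {}pCD : (p %| C * D)%Z by [].
case: (pM _ _ pCD) => [pC|pD].
  case: (pM _ _ pAB) => [pA|pB]; first exact: nop AC pA pC.
  have : (p %| A * D)%Z 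
    by rewrite -[A * D](addrK (B * C)) rpredB // dvdz_mulr.
  by case/pM => [pA|]; [exact: nop AC pA pC|exact: nop BD pB].
case: (pM _ _ pAB) => [pA|pB]; last exact: nop BD pB pD.
have : (p %| B * C)%Z 
  by rewrite -[B * C](addKr (A * D)) rpredD // rpredN dvdz_mulr.
by case/pM => [pB|]; [exact: nop BD pB pD|exact: nop AC pA].
Qed.

(** Only |ad| and |bc| need an argument: they differ by at most m and their product |ab| |cd| is at
    most m^2, so neither exceeds 2m. *)
Lemma max_mul_le (a b c d m : int) :
    `|a * b| <= m -> `|c * d| <= m -> `|a * d + b * c| <= m ->
  Num.max `|a| `|c| * Num.max `|b| `|d| <= 2 * m.
Proof.
move=> h1 h2 h3.
have h4 : `|a| * `|d| <= 2 * m /\ `|b| * `|c| <= 2 * m.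
  rewrite !normrM in h1 h2.
  have h3' : `|a| * `|d| <= m + `|b| * `|c| /\ `|b| * `|c| <= m + `|a| * `|d|.
    rewrite -!normrM; have := ler_normB (a * d + b * c) (b * c).
    have := ler_normB (a * d + b * c) (a * d).
    rewrite addrK addrAC subrr add0r; move: h3; clear; lia.
  have m0 : 0 <= m by apply: le_trans h3.
  have : (`|a| * `|d|) * (`|b| * `|c|) <= m * m.
    have -> : (`|a| * `|d|) * (`|b| * `|c|) = (`|a| * `|b|) * (`|c| * `|d|) by ring.
    by apply: ler_pM.
  move: h3' m0 (mulr_ge0 (normr_ge0 a) (normr_ge0 d)) (mulr_ge0 (normr_ge0 b) (normr_ge0 c)).
  move: (_ * _) (`|b| * _) => u v; clear; nia.
have m0 : 0 <= m by apply: le_trans h3.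
rewrite !normrM in h1 h2.
case: (leP `|a| `|c|) => _; case: (leP `|b| `|d|) => _; move: m0 h1 h2 h4; clear; lia.
Qed.

(** x and y are the roots of T X^2 - S X + P. By primitivity (T, S, P) is an integer multiple of
    (CD, AD + BC, AB), so bounds on the former pass to the latter. *)
Lemma symmetric_height_le (x y : rat) (S P T m : int) :
    T != 0 -> (x + y) * T%:~R = S%:~R -> x * y * T%:~R = P%:~R ->
    `|S| <= m -> `|P| <= m -> `|T| <= m ->
  (maxn `|numq x| `|denq x| * maxn `|numq y| `|denq y|)%N%:Z <= 2 * m.
Proof.
move=> T0 hS hP Sm Pm Tm.
set A := numq x; set C := denq x; set B := numq y; set D := denq y.
have cAC : coprimez A C by exact: coprime_num_den.
have cBD : coprimez B D by exact: coprime_num_den.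
have hC : C%:~R != 0 :> rat by rewrite intr_eq0 denq_eq0.
have hD : D%:~R != 0 :> rat by rewrite intr_eq0 denq_eq0.
have xE : A%:~R = x * C%:~R by rewrite -{1}(divq_num_den x) divfK.
have yE : B%:~R = y * D%:~R by rewrite -{1}(divq_num_den y) divfK.
have hS' : T * (A * D + B * C) = S * (C * D).
  apply: (@intr_inj rat); rewrite !(rmorphM, rmorphD) /= -hS xE yE; ring.
have hP' : T * (A * B) = P * (C * D).
  apply: (@intr_inj rat); rewrite !(rmorphM, rmorphD) /= -hP xE yE; ring.
have CD0 : C * D != 0 by rewrite mulf_neq0 // denq_eq0.
have /dvdzP[g Tg] : (C * D %| T)%Z.
  by apply: (primitive_dvd cAC cBD); rewrite ?hS' ?hP' dvdz_mull.
have Sg : S = g * (A * D + B * C).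
  by apply: (mulIf CD0); rewrite -hS' Tg; ring.
have Pg : P = g * (A * B).
  by apply: (mulIf CD0); rewrite -hP' Tg; ring.
have g0 : g != 0 by apply: contraNneq T0 => g0; rewrite Tg g0 mul0r.
have le z : `|g * z| <= m -> `|z| <= m.
  by apply: le_trans; rewrite normrM ler_peMl // -gtz0_ge1 normr_gt0.
have -> : (maxn `|A| `|C| * maxn `|B| `|D|)%N%:Z =
    Num.max `|A| `|C| * Num.max `|B| `|D| by clear; lia.
apply: max_mul_le; apply: le; [by rewrite -Pg|by rewrite -Tg|by rewrite -Sg].
Qed.

(* Bounds the coefficients of the forms giving x(P+Q) + x(P-Q) and x(P+Q) x(P-Q). *)
Definition biquad_bound (a4 a6 : int) : int := 5 + 6 * `|a4| + 12 * `|a6| + a4 ^+ 2.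

(** For x(P) = A1/D1 and x(Q) = A2/D2, the variables stand for A1 A2, A1 D2, D1 A2, D1 D2. The three
    forms are the numerators of x(P+Q) + x(P-Q) and of x(P+Q) x(P-Q), and their common
    denominator. *)
Lemma biquad_bounds (a b p q r s M : int) :
    `|p| <= M -> `|q| <= M -> `|r| <= M -> `|s| <= M ->
  [/\ `|2 * ((q + r) * (a * s + p) + 2 * b * s ^+ 2)| <= biquad_bound a b * M ^+ 2,
      `|(p - a * s) ^+ 2 - 4 * b * s * (q + r)| <= biquad_bound a b * M ^+ 2
    & `|(q - r) ^+ 2| <= biquad_bound a b * M ^+ 2].
Proof.
move=> pM qM rM sM; have M0 : 0 <= M by apply: le_trans pM.
have ss : `|s| ^+ 2 <= M ^+ 2 by rewrite lerXn2r ?nnegrE.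
have qr : `|q + r| <= 2 * M by apply: le_trans (ler_normD _ _) _; move: qM rM; clear; lia.
have qr' : `|q - r| <= 2 * M by apply: le_trans (ler_normB _ _) _; move: qM rM; clear; lia.
have as_ : `|a * s| <= `|a| * M by rewrite normrM ler_wpM2l.
have ap : `|a * s + p| <= (`|a| + 1) * M.
  by apply: le_trans (ler_normD _ _) _; move: as_ pM; clear; lia.
have pa : `|p - a * s| <= (`|a| + 1) * M.
  by apply: le_trans (ler_normB _ _) _; move: as_ pM; clear; lia.
have a2 : a ^+ 2 = `|a| ^+ 2 by rewrite real_normK ?num_real.
have aM : 0 <= `|a| * M ^+ 2 by rewrite mulr_ge0 ?sqr_ge0.
have aaM : 0 <= `|a| ^+ 2 * M ^+ 2 by rewrite mulr_ge0 ?sqr_ge0.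
have bM : 0 <= `|b| * M ^+ 2 by rewrite mulr_ge0 ?sqr_ge0.
have MM : 0 <= M ^+ 2 by rewrite sqr_ge0.
rewrite /biquad_bound a2; split.
- have h1 : `|(q + r) * (a * s + p)| <= (2 * M) * ((`|a| + 1) * M).
    by rewrite normrM; apply: ler_pM.
  have h2 : `|2 * b * s ^+ 2| <= 2 * `|b| * M ^+ 2.
    by rewrite (normrM (2 * b)) normrX (normrM 2) ler_wpM2l // mulr_ge0.
  rewrite normrM; have := ler_normD ((q + r) * (a * s + p)) (2 * b * s ^+ 2).
  move: h1 h2 aM aaM bM MM; move: `|_ + 2 * b * _| `|_ * (_ + p)| `|2 * b * _| => u v w.
  by rewrite (ger0_norm (isT : 0 <= 2 :> int)); clear; lia.
- have h1 : `|(p - a * s) ^+ 2| <= ((`|a| + 1) * M) ^+ 2.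
    by rewrite normrX lerXn2r // nnegrE // mulr_ge0 // addr_ge0.
  have h2 : `|4 * b * s * (q + r)| <= 4 * `|b| * M * (2 * M).
    by rewrite !normrM; apply: ler_pM => //; rewrite ler_wpM2l // mulr_ge0.
  apply: le_trans (ler_normB _ _) _.
  move: h1 h2 aM aaM bM MM; move: `|_ ^+ 2| `|_ * (q + r)| => u v.
  by clear; lia.
- have h1 : `|(q - r) ^+ 2| <= (2 * M) ^+ 2.
    by rewrite normrX lerXn2r // nnegrE // mulr_ge0.
  apply: le_trans h1 _; move: aM aaM bM MM; clear; lia.
Qed.

Lemma add_coords_chord (K : fieldType) (a4 : int) (x1 y1 x2 y2 : K) : x1 != x2 ->
  add_coords a4 (Some (x1, y1)) (Some (x2, y2)) =
  let x3 := ((y2 - y1) / (x2 - x1)) ^+ 2 - x1 - x2 in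
  Some (x3, (y2 - y1) / (x2 - x1) * (x1 - x3) - y1).
Proof. by move=> /negPf h; rewrite /add_coords /slope h. Qed.

(** x3 and x4 are the abscissas of P + Q and P - Q. Their symmetric functions are even in y1 and y2,
    so the curve equations eliminate both. *)
Lemma chord_sym (a b x1 y1 x2 y2 : rat) : x1 != x2 ->
    y1 ^+ 2 = x1 ^+ 3 + a * x1 + b -> y2 ^+ 2 = x2 ^+ 3 + a * x2 + b ->
  let x3 := ((y2 - y1) / (x2 - x1)) ^+ 2 - x1 - x2 in
  let x4 := ((- y2 - y1) / (x2 - x1)) ^+ 2 - x1 - x2 in
  (x3 + x4) * (x1 - x2) ^+ 2 = 2 * ((x1 + x2) * (a + x1 * x2) + 2 * b) /\
  x3 * x4 * (x1 - x2) ^+ 2 = (x1 * x2 - a) ^+ 2 - 4 * b * (x1 + x2).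
Proof.
move=> hx o1 o2 x3 x4; have dx : x2 - x1 != 0 by rewrite subr_eq0 eq_sym.
have x3E : x3 * (x2 - x1) ^+ 2 = (y2 - y1) ^+ 2 - (x1 + x2) * (x2 - x1) ^+ 2.
  by rewrite /x3; field.
have x4E : x4 * (x2 - x1) ^+ 2 = (y2 + y1) ^+ 2 - (x1 + x2) * (x2 - x1) ^+ 2.
  by rewrite /x4; field.
clearbody x3 x4.
split.
  transitivity (x3 * (x2 - x1) ^+ 2 + x4 * (x2 - x1) ^+ 2); first by ring.
  rewrite x3E x4E; transitivity (2 * (y1 ^+ 2 + y2 ^+ 2) - 2 * (x1 + x2) * (x2 - x1) ^+ 2).
    by ring.
  by rewrite o1 o2; ring.
apply: (mulIf (expf_neq0 2 dx)).
transitivity ((x3 * (x2 - x1) ^+ 2) * (x4 * (x2 - x1) ^+ 2)); first by ring.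
rewrite x3E x4E; transitivity ((y2 ^+ 2 - y1 ^+ 2) ^+ 2
  - 2 * (y2 ^+ 2 + y1 ^+ 2) * ((x1 + x2) * (x2 - x1) ^+ 2) + ((x1 + x2) * (x2 - x1) ^+ 2) ^+ 2).
  by ring.
by rewrite o1 o2; ring.
Qed.

Lemma chord_height_le (a4 a6 : int) (P Q : ecpoint rat a4 a6) (x1 y1 x2 y2 : rat) :
    coords P = Some (x1, y1) -> coords Q = Some (x2, y2) -> x1 != x2 ->
  (naive_height (ec_add P Q) * naive_height (ec_add P (ec_opp Q)))%N%:Z <=
  2 * biquad_bound a4 a6 * ((naive_height P * naive_height Q)%N%:Z) ^+ 2.
Proof.
case: P Q => [P oP] [Q oQ] /= eP eQ hx; subst P Q.
have /eqP o1 := oP; have /eqP o2 := oQ.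
have := chord_sym hx o1 o2.
rewrite /naive_height /coords /ec_add /ec_opp /opp_coords !add_coords_chord //.
set x3 := _ - x1 - x2; set x4 := (_ - x1 - x2) => /= -[hs hp].
pose A1 := numq x1; pose D1 := denq x1; pose A2 := numq x2; pose D2 := denq x2.
rewrite -/A1 -/D1 -/A2 -/D2.
have hD1 : D1%:~R != 0 :> rat by rewrite intr_eq0 denq_eq0.
have hD2 : D2%:~R != 0 :> rat by rewrite intr_eq0 denq_eq0.
have x1E : A1%:~R = x1 * D1%:~R by rewrite -{1}(divq_num_den x1) divfK.
have x2E : A2%:~R = x2 * D2%:~R by rewrite -{1}(divq_num_den x2) divfK.
pose M := (maxn `|A1| `|D1| * maxn `|A2| `|D2|)%N%:Z; rewrite -/M.
have bnd (u v : int) : (`|u| <= maxn `|A1| `|D1|)%N -> (`|v| <= maxn `|A2| `|D2|)%N ->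
    `|u * v| <= M.
  by move=> h1 h2; rewrite /M -abszE abszM lez_nat leq_mul.
have pM : `|A1 * A2| <= M by rewrite bnd ?leq_maxl.
have qM : `|A1 * D2| <= M by rewrite bnd ?leq_maxl ?leq_maxr.
have rM : `|D1 * A2| <= M by rewrite bnd ?leq_maxl ?leq_maxr.
have sM : `|D1 * D2| <= M by rewrite bnd ?leq_maxr.
have [Sle Ple Tle] := biquad_bounds a4 a6 pM qM rM sM.
rewrite -mulrA; apply: symmetric_height_le Sle Ple Tle.
- rewrite expf_neq0 // subr_eq0; apply: contra hx => /eqP/(congr1 (intr : int -> rat)).
  rewrite !rmorphM /= x1E x2E => h; apply/eqP.
  by apply: (mulIf (mulf_neq0 hD1 hD2)); rewrite mulrA h; ring.
- rewrite !(rmorph_nat, rmorphM, rmorphD, rmorphN, rmorphXn) /= x1E x2E.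
  transitivity ((x3 + x4) * (x1 - x2) ^+ 2 * (D1%:~R * D2%:~R) ^+ 2); first by ring.
  by rewrite hs; ring.
- rewrite !(rmorph_nat, rmorphM, rmorphD, rmorphN, rmorphXn) /= x1E x2E.
  transitivity (x3 * x4 * (x1 - x2) ^+ 2 * (D1%:~R * D2%:~R) ^+ 2); first by ring.
  by rewrite hp; ring.
Qed.

(** * Height of 2P and the parallelogram inequality *)

Lemma naive_height_ge1 (a4 a6 : int) (P : ecpoint rat a4 a6) : (1 <= naive_height P)%N.
Proof.
rewrite /naive_height; case: (coords P) => [[x y]|] //.
by rewrite leq_max !absz_gt0 denq_eq0 orbT.
Qed.

Lemma naive_height_opp (a4 a6 : int) (P : ecpoint rat a4 a6) :
  naive_height (ec_opp P) = naive_height P.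
Proof. by case: P => -[[x y]|]. Qed.

Lemma dup_numE (a4 a6 : int) (x : rat) :
  (dup_num a4 a6 (numq x) (denq x))%:~R = (denq x)%:~R ^+ 4 *
    (x ^+ 4 - 2 * a4%:~R * x ^+ 2 - 8 * a6%:~R * x + a4%:~R ^+ 2).
Proof.
have hD : (denq x)%:~R != 0 :> rat by rewrite intr_eq0 denq_eq0.
rewrite /dup_num !(rmorph_nat, rmorphM, rmorphD, rmorphN, rmorphXn) /=.
have -> : (numq x)%:~R = x * (denq x)%:~R by rewrite -{2}(divq_num_den x) divfK.
by ring.
Qed.

Lemma dup_denE (a4 a6 : int) (x : rat) :
  (dup_den a4 a6 (numq x) (denq x))%:~R = (denq x)%:~R ^+ 4 *
    (4 * (x ^+ 3 + a4%:~R * x + a6%:~R)).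
Proof.
have hD : (denq x)%:~R != 0 :> rat by rewrite intr_eq0 denq_eq0.
rewrite /dup_den !(rmorph_nat, rmorphM, rmorphD, rmorphN, rmorphXn) /=.
have -> : (numq x)%:~R = x * (denq x)%:~R by rewrite -{2}(divq_num_den x) divfK.
by ring.
Qed.

Lemma naive_height_double (a4 a6 : int) (P : ecpoint rat a4 a6) (x y : rat) :
    coords P = Some (x, y) ->
    coprimez (dup_num a4 a6 (numq x) (denq x)) (dup_den a4 a6 (numq x) (denq x)) ->
  naive_height (ec_add P P) = maxn `|dup_num a4 a6 (numq x) (denq x)|%N
                                   `|dup_den a4 a6 (numq x) (denq x)|%N.
Proof.
case: P => P oP /= eP; subst P; have /eqP o := oP.
have := dup_numE a4 a6 x; have := dup_denE a4 a6 x.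
set N := dup_num _ _ _ _; set E := dup_den _ _ _ _; rewrite -o => eE eN cop.
have hD : (denq x)%:~R != 0 :> rat by rewrite intr_eq0 denq_eq0.
rewrite /naive_height /ec_add /= eqxx /=.
(* At a 2-torsion point [dup_den] is 0, so coprimality makes [dup_num] a unit, in agreement with
   height 1 at the identity. *)
have [y0|y0] := eqVneq y (- y).
  have E0 : E = 0.
    apply: (@intr_inj rat); rewrite eE.
    have -> : y = 0 by move: y0; lra.
    by rewrite expr0n !mulr0.
  by move: cop; rewrite /coprimez /gcdz E0 gcdn0 maxn0 => /eqP[->].
have y2 : 2 * y != 0 by rewrite mulr_natl mulr2n addr_eq0.
have yn0 : y != 0 by apply: contraNneq y2 => ->; rewrite mulr0.
have E0 : 0 < E.
  rewrite -(ltr_int rat) eE mulr_gt0 ?exprn_even_gt0 //.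
  by rewrite mulr_gt0 // exprn_even_gt0.
have -> : slope a4 x y x y ^+ 2 - x - x = N%:~R / E%:~R.
  rewrite /slope eqxx eN eE.
  have -> : x ^+ 4 - 2 * a4%:~R * x ^+ 2 - 8 * a6%:~R * x + a4%:~R ^+ 2 =
      (3 * x ^+ 2 + a4%:~R) ^+ 2 - 8 * x * y ^+ 2 by rewrite o; ring.
  by field; rewrite hD yn0.
by rewrite coprimeq_num // coprimeq_den // gtr0_sg // mul1r gt_eqF // abszE.
Qed.

(** Multiplying by D^4, the bound num >= x^4 controls A^4 and the alternative lower bound 1 controls
    D^4. *)
Lemma naive_height_double_ge (a4 a6 : int) (P : ecpoint rat a4 a6) (x y : rat) :
    coords P = Some (x, y) ->
    coprimez (dup_num a4 a6 (numq x) (denq x)) (dup_den a4 a6 (numq x) (denq x)) ->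
    let num := x ^+ 4 - 2 * a4%:~R * x ^+ 2 - 8 * a6%:~R * x + a4%:~R ^+ 2 in
    x ^+ 4 <= num ->
    1 <= num \/ 1 <= 4 * (x ^+ 3 + a4%:~R * x + a6%:~R) ->
  (naive_height P ^ 4 <= naive_height (ec_add P P))%N.
Proof.
move=> eP cop num h4 h1; rewrite (naive_height_double eP cop).
have := dup_numE a4 a6 x; have := dup_denE a4 a6 x.
set N := dup_num _ _ _ _; set E := dup_den _ _ _ _; rewrite -/num => eE eN.
rewrite /naive_height eP; set A := numq x; set D := denq x.
have D40 : 0 <= D%:~R ^+ 4 :> rat by rewrite exprn_even_ge0.
have xD : A%:~R = x * D%:~R.
  by rewrite -{1}(divq_num_den x) divfK // intr_eq0 denq_eq0.
have nn (z : int) : (`|z| ^ 4)%N%:Z = z ^+ 4.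
  by rewrite -abszX abszE ger0_norm // exprn_even_ge0.
have hA : (`|A| ^ 4 <= `|N|)%N.
  rewrite -lez_nat nn abszE; apply: le_trans (ler_norm _).
  rewrite -(ler_int rat) eN rmorphXn /= xD exprMn mulrC.
  by rewrite ler_wpM2l.
have hD : (`|D| ^ 4 <= maxn `|N| `|E|)%N.
  rewrite leq_max -!lez_nat nn !abszE; apply/orP.
  by case: h1 => h1; [left|right]; apply: le_trans (ler_norm _);
    rewrite -(ler_int rat) ?eN ?eE rmorphXn /= ler_peMr.
case: (leqP `|A| `|D|) => _; last exact: leq_trans hA (leq_maxl _ _).
exact: hD.
Qed.

(** The degenerate case Q = P of the chord bound: the common denominator vanishes, but the other two
    forms specialize to [dup_den] and [dup_num]. *)
Lemma naive_height_double_le (a4 a6 : int) (P : ecpoint rat a4 a6) (x y : rat) :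
    coords P = Some (x, y) ->
    coprimez (dup_num a4 a6 (numq x) (denq x)) (dup_den a4 a6 (numq x) (denq x)) ->
  (naive_height (ec_add P P))%:Z <=
    biquad_bound a4 a6 * ((naive_height P * naive_height P)%N%:Z) ^+ 2.
Proof.
move=> eP cop; rewrite (naive_height_double eP cop) /naive_height eP.
set A := numq x; set D := denq x; pose H := maxn `|A| `|D|.
have bnd (u v : int) : (`|u| <= H)%N -> (`|v| <= H)%N -> `|u * v| <= (H * H)%N%:Z.
  by move=> h1 h2; rewrite -abszE abszM lez_nat leq_mul.
have pM : `|A * A| <= (H * H)%N%:Z by rewrite bnd ?leq_maxl.
have qM : `|A * D| <= (H * H)%N%:Z by rewrite bnd ?leq_maxl ?leq_maxr.
have sM : `|D * D| <= (H * H)%N%:Z by rewrite bnd ?leq_maxr.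
have [Sle Ple _] := biquad_bounds a4 a6 pM qM qM sM.
rewrite -/H; set B := _ * _ ^+ 2 in Sle Ple *.
have -> : dup_num a4 a6 A D = (A * A - a4 * (D * D)) ^+ 2 - 4 * a6 * (D * D) * (A * D + A * D).
  by rewrite /dup_num; ring.
have -> : dup_den a4 a6 A D =
    2 * ((A * D + A * D) * (a4 * (D * D) + A * A) + 2 * a6 * (D * D) ^+ 2).
  by rewrite /dup_den; ring.
by case: (leqP `|_ ^+ 2 - _|) => _; rewrite abszE.
Qed.

Lemma parallelogram_le (a4 a6 : int) (P Q : ecpoint rat a4 a6) :
    (forall x y : rat, on_curve a4 a6 (Some (x, y)) ->
      coprimez (dup_num a4 a6 (numq x) (denq x)) (dup_den a4 a6 (numq x) (denq x))) ->
  (naive_height (ec_add P Q) * naive_height (ec_add P (ec_opp Q)))%N%:Z <=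
  2 * biquad_bound a4 a6 * ((naive_height P * naive_height Q)%N%:Z) ^+ 2.
Proof.
move=> cop; have b1 : 1 <= 2 * biquad_bound a4 a6.
  by rewrite /biquad_bound; have := sqr_ge0 a4; lia.
have triv (n : nat) : (n * n)%N%:Z <= 2 * biquad_bound a4 a6 * n%:Z ^+ 2.
  by rewrite PoszM -expr2 ler_peMl // sqr_ge0.
have dbl (T : ecpoint rat a4 a6) : coords T != None ->
    (naive_height (ec_add T T))%:Z <=
    2 * biquad_bound a4 a6 * ((naive_height T * naive_height T)%N%:Z) ^+ 2.
  case: T => -[[x y]|] oT // _.
  have /le_trans := @naive_height_double_le _ _ (ECPoint oT) x y erefl (cop x y oT); apply.
  by rewrite -mulrA ler_peMl // mulr_ge0 ?sqr_ge0 // /biquad_bound; have := sqr_ge0 a4; lia.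
have [P0|Pn] := eqVneq (coords P) None.
  have -> : P = ec_zero rat a4 a6 by exact: ec_eqP.
  by rewrite !ec_add0 naive_height_opp mul1n.
have [Q0|Qn] := eqVneq (coords Q) None.
  have -> : Q = ec_zero rat a4 a6 by exact: ec_eqP.
  rewrite (_ : ec_opp _ = ec_zero rat a4 a6); last exact: ec_eqP.
  by rewrite !ec_addr0 muln1.
have [QP|QP] := pselect (Q = P).
  by rewrite QP ec_addN muln1 dbl.
have [QoP|QoP] := pselect (Q = ec_opp P).
  by rewrite QoP ec_addN ec_oppK naive_height_opp mul1n dbl.
case eP : (coords P) Pn => [[x1 y1]|] // _; case eQ : (coords Q) Qn => [[x2 y2]|] // _.
apply: (chord_height_le eP eQ); apply/eqP => ex.
have := on_curve_coords P; rewrite eP => /eqP o1.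
have := on_curve_coords Q; rewrite eQ -ex => /eqP o2.
have /eqP : y2 ^+ 2 = y1 ^+ 2 by rewrite o1 o2.
rewrite eqf_sqr => /orP[] /eqP ey.
  by apply: QP; apply: ec_eqP; rewrite eP eQ ex ey.
by apply: QoP; apply: ec_eqP; rewrite eQ /= eP /= ex ey.
Qed.

(** * The canonical height *)

(* Applied to m + n and m - n, the two hypotheses also give the reverse inequality, up to C. *)
Lemma approx_quadratic (R : realType) (g : nat -> R) (C : R) :
    (forall n, 4 * g n <= g (n + n)%N) ->
    (forall m n, (n <= m)%N -> g (m + n)%N + g (m - n)%N <= 2 * g m + 2 * g n + C) ->
  forall n k, `|g (k.+1 * n)%N - k.+1%:R ^+ 2 * g n| <= k.+1%:R ^+ 2 * C.
Proof.
move=> hd hu n.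
have hl m j : (j <= m)%N -> 2 * g m + 2 * g j - C <= g (m + j)%N + g (m - j)%N.
  move=> jm; have := hu (m + j)%N (m - j)%N (leq_trans (leq_subr _ _) (leq_addr _ _)).
  have -> : (m + j + (m - j) = m + m)%N by lia.
  have -> : (m + j - (m - j) = j + j)%N by lia.
  have := hd m; have := hd j; have := hu m j jm; lra.
have C0 : 0 <= C by have := hu 0%N 0%N isT; have := hl 0%N 0%N isT; rewrite addn0 subn0; lra.
have g0 : `|g 0%N| <= C.
  by have := hu 0%N 0%N isT; have := hl 0%N 0%N isT; rewrite addn0 subn0 ler_norml; lra.
(* The deviation from quadratic growth has second differences bounded by C, with [e 1 = 0] and |e 0|
   <= C; summing twice gives the bound. *)
pose e k := g (k * n)%N - k%:R ^+ 2 * g n.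
have e2 k : `|e k.+2 - 2 * e k.+1 + e k| <= C.
  have le : (n <= k.+1 * n)%N by rewrite mulSn leq_addr.
  have := hu _ _ le; have := hl _ _ le.
  have -> : (k.+1 * n + n = k.+2 * n)%N by lia.
  have -> : (k.+1 * n - n = k * n)%N by lia.
  move=> h1 h2; rewrite /e ler_norml -[k.+2%:R]natr1 -[k.+1%:R]natr1.
  set G := g n in h1 h2 *; set t : R := k%:R.
  have -> : g (k.+2 * n)%N - (t + 1 + 1) ^+ 2 * G -
      2 * (g (k.+1 * n)%N - (t + 1) ^+ 2 * G) + (g (k * n)%N - t ^+ 2 * G) =
      g (k.+2 * n)%N + g (k * n)%N - 2 * g (k.+1 * n)%N - 2 * G by ring.
  by apply/andP; split; lra.
have e1 : e 1%N = 0 by rewrite /e mul1n expr1n mul1r subrr.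
have he0 : `|e 0%N| <= C by rewrite /e mul0n expr0n mul0r subr0.
have d k : `|e k.+1 - e k| <= k.+1%:R * C.
  elim: k => [|k IH]; first by rewrite e1 sub0r normrN mul1r.
  have := e2 k; move: IH; rewrite !ler_norml -[k.+2%:R]natr1 mulrDl mul1r.
  by move=> /andP[? ?] /andP[? ?]; apply/andP; split; lra.
rewrite -/(e _); elim=> [|k IH]; first by rewrite -/(e 1%N) e1 normr0 expr1n mul1r.
rewrite -/(e k.+2); rewrite -/(e k.+1) in IH.
have {}IH := le_trans (ler_normD (e k.+2 - e k.+1) (e k.+1)) (lerD (d k.+1) IH).
rewrite subrK in IH; apply: le_trans IH _; rewrite -mulrDl ler_wpM2r //.
by rewrite -[k.+2%:R]natr1; have : 0 <= k.+1%:R :> R by []; nra.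
Qed.

(* The sequence g(2^k)/4^k is nondecreasing and bounded; its limit is that of g(n)/n^2. *)
Lemma quasi_quadratic_lim (R : realType) (g : nat -> R) (C : R) :
    (forall n, 4 * g n <= g (n + n)%N) ->
    (forall m n, (n <= m)%N -> g (m + n)%N + g (m - n)%N <= 2 * g m + 2 * g n + C) ->
  g 1%N <= limn (fun n => g n / n%:R ^+ 2).
Proof.
move=> hd hu; have hq := approx_quadratic hd hu.
have sqr_gt0 n : 0 < n.+1%:R ^+ 2 :> R by rewrite exprn_gt0.
have C0 : 0 <= C.
  by have := hq 1%N 0%N; rewrite expr1n mul1r mul1n subrr normr0 mul1r.
pose u n := g n / n%:R ^+ 2.
have hu2 n k : `|u (k.+1 * n.+1)%N - u n.+1| <= C / n.+1%:R ^+ 2.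
  have := hq n.+1 k; rewrite /u natrM exprMn.
  set G := g (_ * _)%N; set N := n.+1%:R ^+ 2; set M := k.+1%:R ^+ 2.
  have N0 : 0 < N by exact: sqr_gt0.
  have M0 : 0 < M by exact: sqr_gt0.
  have -> : G / (M * N) - g n.+1 / N = (G - M * g n.+1) / (M * N).
    by field; rewrite ?gt_eqF.
  rewrite normrM normfV (gtr0_norm (mulr_gt0 M0 N0)) => h.
  by rewrite ler_pdivrMr ?mulr_gt0 // mulrCA divfK ?gt_eqF.
(* Both terms are compared with the value of u at the product of the two indices. *)
have hu3 m n : `|u m.+1 - u n.+1| <= C / n.+1%:R ^+ 2 + C / m.+1%:R ^+ 2.
  have -> : u m.+1 - u n.+1 =
     (u (m.+1 * n.+1)%N - u n.+1) - (u (n.+1 * m.+1)%N - u m.+1).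
    by rewrite mulnC; ring.
  by apply: le_trans (ler_normB _ _) (lerD _ _).
pose v k := u (2 ^ k)%N.
have v_nd : nondecreasing_seq v.
  apply/nondecreasing_seqP => j; rewrite /v /u expnS mul2n -addnn.
  set t : R := (2 ^ j)%N%:R; have t_gt0 : 0 < t by rewrite ltr0n expn_gt0.
  have t0 : 0 < t ^+ 2 by rewrite exprn_gt0.
  have := hd (2 ^ j)%N; rewrite natrD -/t => h.
  have -> : (t + t) ^+ 2 = 4 * t ^+ 2 by ring.
  rewrite ler_pdivlMr ?mulr_gt0 //.
  by rewrite mulrCA divfK ?gt_eqF.
have v_ub : has_ubound (range v).
  exists (u 1%N + (C + C)) => _ [k _ <-]; rewrite /v.
  have /prednK <- : (0 < 2 ^ k)%N by rewrite expn_gt0.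
  have := hu3 (2 ^ k).-1 0%N; rewrite ler_norml => /andP[_].
  rewrite expr1n divr1; set x := C / _ => hx.
  have : x <= C by rewrite /x ler_pdivrMr // ler_peMr // exprn_ege1 // ler1n.
  by lra.
have v_cvg := nondecreasing_is_cvgn v_nd v_ub.
have h0 : (fun n => C / n.+1%:R ^+ 2) @ \oo --> (0 : R).
  have -> : (fun n => C / n.+1%:R ^+ 2) = (fun n => C * (@harmonic R n * @harmonic R n)).
    by apply/funext => n; rewrite /harmonic /= -expr2 exprVn.
  have -> : 0 = C * (0 * 0) :> R by rewrite !mulr0.
  by apply: cvgMr; apply: cvgM; exact: cvg_harmonic.
suff u_cvg : u @ \oo --> limn v.
  rewrite (cvg_lim _ u_cvg) //.
  have := nondecreasing_cvgn_le v_nd v_cvg 0%N; apply: le_trans.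
  by rewrite /v /u expr1n divr1.
rewrite -(cvg_shiftS u); apply/cvgrPdist_le => e e0.
have e3 : 0 < e / 3 by rewrite divr_gt0.
have [N _ hN] := (cvgrPdist_le _ _).1 h0 _ e3.
have [M _ hM] := (cvgrPdist_le _ _).1 v_cvg _ e3.
exists N => // n /= Nn.
(* With this k, 2^k exceeds N and v k is within e/3 of its limit. *)
pose k := maxn N M.
have hk := hM k (leq_maxr _ _).
have h1 := hN n Nn.
have h2 : `|0 - C / (2 ^ k).-1.+1%:R ^+ 2| <= e / 3.
  by apply: hN => /=; have := ltn_expl k (ltnSn 1); have := leq_maxl N M; rewrite -/k; lia.
have := hu3 (2 ^ k).-1 n.
have e0' m : `|0 - C / m.+1%:R ^+ 2| = C / m.+1%:R ^+ 2.
  by rewrite sub0r normrN ger0_norm // divr_ge0 // ltW.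
rewrite !e0' in h1 h2.
have ek : (2 ^ k).-1.+1 = (2 ^ k)%N by rewrite prednK ?expn_gt0.
rewrite ek in h2 *; rewrite -/(v k) => h3.
have -> : limn v - u n.+1 = (limn v - v k) + (v k - u n.+1) by ring.
apply: le_trans (ler_normD _ _) _.
have -> : e = e / 3 + (e / 3 + e / 3) by lra.
by apply: lerD => //; apply: le_trans h3 _; apply: lerD.
Qed.

Lemma ec_mulnD (K : fieldType) (a4 a6 : int) (P : ecpoint K a4 a6) (m n : nat) :
    (discriminant a4 a6)%:~R != 0 :> K ->
  ec_muln P (m + n)%N = ec_add (ec_muln P m) (ec_muln P n).
Proof.
move=> hd; elim: m => [|m IH]; first by rewrite ec_add0.
by rewrite addSn /ec_muln !iterS -!/(ec_muln _ _) IH ec_addA.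
Qed.

Lemma ec_mulnB (K : fieldType) (a4 a6 : int) (P : ecpoint K a4 a6) (m n : nat) :
    (discriminant a4 a6)%:~R != 0 :> K -> (n <= m)%N ->
  ec_muln P (m - n)%N = ec_add (ec_muln P m) (ec_opp (ec_muln P n)).
Proof.
move=> hd nm; rewrite -[in RHS](subnKC nm) ec_mulnD //.
by rewrite ec_addC ec_addK.
Qed.

(** For g(n) = h_W(nP), logarithms turn growth under doubling into 4 g(n) <= g(2n), and the
    parallelogram bound into approximate subquadraticity with constant ln(2 [biquad_bound]). *)
Lemma canonical_height_ge (R : realType) (a4 a6 : int) (P : ecpoint rat a4 a6) :
    is_elliptic_curve a4 a6 ->
    (forall x y : rat, on_curve a4 a6 (Some (x, y)) ->
      coprimez (dup_num a4 a6 (numq x) (denq x)) (dup_den a4 a6 (numq x) (denq x))) ->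
    (forall Q : ecpoint rat a4 a6, naive_height Q ^ 4 <= naive_height (ec_add Q Q))%N ->
  2^-1 * log_height R P <= canonical_height R P.
Proof.
move=> hE cop dbl; have hd : (discriminant a4 a6)%:~R != 0 :> rat by rewrite intr_eq0.
have H0 (Q : ecpoint rat a4 a6) : (0 < (naive_height Q)%:R :> R).
  by rewrite ltr0n naive_height_ge1.
pose g n := log_height R (ec_muln P n).
rewrite /canonical_height ler_pM2l ?invr_gt0 //.
have -> : log_height R P = g 1%N by rewrite /g /= ec_addr0.
pose k : R := (2 * biquad_bound a4 a6)%:~R; have k0 : 0 < k.
  by rewrite ltr0z /biquad_bound; have := sqr_ge0 a4; lia.
apply: (@quasi_quadratic_lim R g (ln k)) => [n|m n nm].
  rewrite /g ec_mulnD // /log_height mulr_natl -lnXn //.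
  by rewrite ler_ln ?posrE ?exprn_gt0 // -natrX ler_nat dbl.
rewrite /g ec_mulnD // ec_mulnB // /log_height !mulr_natl -!lnXn // -!lnM ?posrE ?mulr_gt0 ?exprn_gt0 //.
rewrite ler_ln ?posrE ?mulr_gt0 ?exprn_gt0 //.
have := parallelogram_le (ec_muln P m) (ec_muln P n) cop.
have intrMX (u v : int) : (u * v ^+ 2)%:~R = u%:~R * v%:~R ^+ 2 :> R.
  by rewrite -rmorphXn -rmorphM.
rewrite -(ler_int R) intrMX -/k -!pmulrn !natrM exprMn.
by rewrite [X in _ <= X -> _]mulrC.
Qed.

Lemma canonical_height_ge_region (R : realType) (a4 a6 : int) :
    is_elliptic_curve a4 a6 ->
    (forall v : finite_place,
      bad_reduction v a4 a6 -> tamagawa_number v a4 a6 = 1%N) ->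
    a4 <= 0 ->
    (forall z : R, 0 < z ^+ 3 + a4%:~R * z + a6%:~R ->
      2 * a4%:~R * z ^+ 2 + 8 * a6%:~R * z - a4%:~R ^+ 2 < 0) ->
  forall P : ecpoint rat a4 a6, 2^-1 * log_height R P <= canonical_height R P.
Proof.
move=> hE htam a4le H P.
have cop x y : on_curve a4 a6 (Some (x, y)) -> _ := coprime_duplication htam (y := y).
apply: canonical_height_ge => //; case=> -[[x y]|] oQ; last first.
  by rewrite exp1n naive_height_ge1.
have /eqP o := oQ.
have [e1|n1] := eqVneq (a4, a6) (-2, 1).
  (* At (0, 1) on y^2 = x^3 - 2x + 1 both [dup_num] and [dup_den] equal 4, so they are not
     coprime. *)
  by exfalso; case: e1 (cop 0 1) => -> ->; move=> /(_ (introT eqP erefl)).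
have [[e1 e2]|n2] := eqVneq (a4, a6) (-2, -1).
  have x1 : x = -1.
    by apply: (@curve_m2_m1_points x y); rewrite o e1 e2; ring.
  have -> : naive_height (ECPoint oQ) = 1%N by rewrite /naive_height /= x1.
  by rewrite exp1n naive_height_ge1.
have hd : 4 * a4%:~R ^+ 3 + 27 * a6%:~R ^+ 2 != 0 :> rat.
  move: hE; rewrite /is_elliptic_curve /discriminant mulf_eq0 /=.
  by rewrite -(intr_eq0 rat) !(rmorph_nat, rmorphM, rmorphD, rmorphXn).
have Hq (z : rat) : 0 < z ^+ 3 + a4%:~R * z + a6%:~R ->
    2 * a4%:~R * z ^+ 2 + 8 * a6%:~R * z - a4%:~R ^+ 2 < 0.
  rewrite -(ltr_rat R) => fz; rewrite -(ltr_rat R); move: fz (H (ratr z)).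
  rewrite !(rmorph_nat, rmorph0, rmorphM, rmorphD, rmorphN, rmorphXn) /= !ratr_int.
  by move=> fz /(_ fz).
have f0 : 0 <= x ^+ 3 + a4%:~R * x + a6%:~R by rewrite -o sqr_ge0.
have [h4 h1] := dup_bound a4le Hq hd (elimN eqP n1) (elimN eqP n2) f0.
by apply: (naive_height_double_ge (y := y)) => //; exact: cop oQ.
Qed.

(** * The region where the real cubic is positive *)

Lemma cubic_root_below (R : realType) (a b z : R) :
    0 < z ^+ 3 + a * z + b ->
  exists2 r, r < z & r ^+ 3 + a * r + b = 0.
Proof.
move=> fz; pose p : {poly R} := 'X^3 + a *: 'X + b%:P.
have pE r : p.[r] = r ^+ 3 + a * r + b by rewrite /p !hornerE.
(* This t makes the cubic nonpositive at -t, so the intermediate value theorem applies on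
   [-t, z]. *)
have [t [t1 abt zt]] : exists t, [/\ 1 <= t, `|a| + `|b| <= t & - z <= t].
  exists (`|a| + `|b| + `|z| + 1); have := ler_norm (- z); rewrite normrN.
  by move: (normr_ge0 a) (normr_ge0 b) (normr_ge0 z); clear; split; lra.
have t0 : 0 <= t by apply: le_trans t1.
have tz : - t <= z by rewrite lerNl.
have ft : p.[- t] <= 0.
  rewrite pE; have h1 := ler_norm (- a); have h2 := ler_norm b; rewrite normrN in h1.
  have h3 : - a * t <= `|a| * t by rewrite ler_wpM2r.
  have h4 : `|b| <= `|b| * t by rewrite ler_peMr.
  have h5 : (`|a| + `|b|) * t <= t * t by rewrite ler_wpM2r.
  have h6 : t * t <= t ^+ 3 by rewrite [t ^+ 3]exprS expr2 ler_peMl // mulr_ge0.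
  by move: h2 h3 h4 h5 h6; clear; lra.
have [r /andP[_ rz] /eqP pr] : exists2 r, - t <= r <= z & root p r.
  by apply: (poly_ivt tz); rewrite ft pE ltW.
exists r; last by rewrite -pE.
rewrite lt_neqAle rz andbT; apply: contraTneq fz => <-.
by rewrite -pE pr ltxx.
Qed.

(** Divided differences of the three equations give x + y + z = 0 and express a and b through the
    roots. *)
Lemma cubic_factor (R : realType) (a b x y z : R) :
    x < y -> y < z -> x ^+ 3 + a * x + b = 0 -> y ^+ 3 + a * y + b = 0 ->
    z ^+ 3 + a * z + b = 0 ->
  forall t, t ^+ 3 + a * t + b = (t - x) * (t - y) * (t - z).
Proof.
move=> xy yz fx fy fz t.
have e1 : x ^+ 2 + x * y + y ^+ 2 + a = 0.
  apply: (@mulfI _ (x - y)); first by rewrite subr_eq0 lt_eqF.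
  by rewrite mulr0 -[RHS](subrr (0 : R)) -{1}fx -fy; ring.
have e2 : y ^+ 2 + y * z + z ^+ 2 + a = 0.
  apply: (@mulfI _ (y - z)); first by rewrite subr_eq0 lt_eqF.
  by rewrite mulr0 -[RHS](subrr (0 : R)) -{1}fy -fz; ring.
have e3 : z = - x - y.
  apply: (@mulfI _ (x - z)); first by rewrite subr_eq0 lt_eqF // (lt_trans xy).
  apply/eqP; rewrite -subr_eq0; apply/eqP; rewrite -[RHS](subrr (0 : R)) -{1}e1 -e2; ring.
have eb : b = - x ^+ 3 - a * x by rewrite -[LHS]subr0 -fx; ring.
have ea : a = - (x ^+ 2 + x * y + y ^+ 2) by rewrite -[LHS]subr0 -e1; ring.
by rewrite eb e3 ea; ring.
Qed.

Theorem proposition1p3 (R : realType) (a4 a6 : int)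
    (hE : is_elliptic_curve a4 a6)
    (hrank : has_positive_rank rat a4 a6)
    (htam : forall v : finite_place,
      bad_reduction v a4 a6 -> tamagawa_number v a4 a6 = 1%N) :
  (forall alpha : R,
     has_n_components R a4 a6 1 ->
     (forall x : R, x ^+ 3 + a4%:~R * x + a6%:~R = 0 <-> x = alpha) ->
     a4 <= 0 ->
     `]alpha, +oo[ `<=`
       [set x : R | 2 * a4%:~R * x ^+ 2 + 8 * a6%:~R * x - a4%:~R ^+ 2 < 0] ->
     forall P : ecpoint rat a4 a6,
       canonical_height R P >= 2^-1 * log_height R P) /\
  (forall alpha beta gamma : R,
     has_n_components R a4 a6 2 ->
     gamma < beta -> beta < alpha ->
     (forall x : R, x ^+ 3 + a4%:~R * x + a6%:~R = 0 <->
        [\/ x = gamma, x = beta | x = alpha]) ->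
     a4 <= 0 ->
     `]gamma, beta[ `|` `]alpha, +oo[ `<=`
       [set x : R | 2 * a4%:~R * x ^+ 2 + 8 * a6%:~R * x - a4%:~R ^+ 2 < 0] ->
     forall P : ecpoint rat a4 a6,
       canonical_height R P >= 2^-1 * log_height R P).
Proof.
split=> [alpha _ root1 a4le sub|alpha beta gamma _ gb ba roots a4le sub];
  apply: canonical_height_ge_region => // z fz; apply: sub.
  rewrite /= in_itv /= andbT; have [r rz /root1 <-] := cubic_root_below fz.
  exact: rz.
have rt x : [\/ x = gamma, x = beta | x = alpha] -> _ := (roots x).2.
have fE := cubic_factor gb ba (rt gamma ltac:(by constructor 1))
  (rt beta ltac:(by constructor 2)) (rt alpha ltac:(by constructor 3)).
(* For z <= alpha, the sign of the product of three linear factors leaves gamma < z < beta. *)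
have [za|za] := ltP alpha z; [right|left]; rewrite /= in_itv /= ?za //.
move: fz; rewrite fE; have [zb|zb] := ltP z beta.
  rewrite andbT => h; rewrite ltNge; apply/negP => zg; move: h; apply/negP; rewrite -leNgt.
  rewrite mulr_ge0_le0 ?subr_le0 // mulr_le0 ?subr_le0 //; exact: ltW.
move=> h; exfalso; move: h; apply/negP; rewrite -leNgt.
rewrite mulr_ge0_le0 ?subr_le0 // mulr_ge0 ?subr_ge0 //.
exact: ltW (lt_le_trans gb zb).
Qed.
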